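(* Let $\phi$ be the Laplace exponent of a subordinator killed at rate $\kappa\ge 0$, $\phi$ not identically zero. For any $\kappa,\beta\ge 0$ the following identity of laws holds: $$f_{\mathcal{T}_\beta\phi}(dx)=\frac{x^{\beta}f_\phi(dx)}{\mathbb{E}[I_\phi^{\beta}]},\qquad x>0.$$
   Context: $\xi$ is a subordinator (non-negative valued Lévy process) killed at an independent rate $\kappa\ge 0$ (no killing if $\kappa=0$), with Laplace exponent $\phi$ given by $\mathbb{E}(e^{-u\xi_t})=e^{-\phi(u)t}$, $u,t\ge 0$, so $\phi(0)=\kappa$. Its exponential functional is $$I_\phi=\int_0^{\mathbf{e}_\kappa}e^{-\xi_s}\,ds,$$ where in this formula $\xi$ denotes the unkilled process and $\mathbf{e}_\kappa$ is an independent exponential random variable with mean $\kappa^{-1}$ ($\mathbf{e}_0=\infty$). $f_\phi(dx)$ denotes the law of $I_\phi$. For $\beta\ge 0$, $\mathcal{T}_\beta\phi(u)=\frac{u}{u+\beta}\,\phi(u+\beta)$ (with $\mathcal{T}_0\phi=\phi$); it is again the Laplace exponent of a subordinator (unkilled when $\beta>0$), and $I_{\mathcal{T}_\beta\phi}$, $f_{\mathcal{T}_\beta\phi}$ denote the corresponding exponential functional and its law. *)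

(* Defs.v *)
From mathcomp Require Import all_boot all_order all_algebra.
From mathcomp Require Import all_classical all_reals all_analysis.
From mathcomp Require Import measurable_realfun.

Set Implicit Arguments.
Unset Strict Implicit.
Unset Printing Implicit Defensive.

Import Order.TTheory GRing.Theory Num.Theory.
Import numFieldNormedType.Exports.

Local Open Scope classical_set_scope.
Local Open Scope ring_scope.

Definition independent_systems d (T : measurableType d) (R : realType)
    (P : probability T R) (F G : set (set T)) : Prop :=
  forall A B, F A -> G B -> P (A `&` B) = (P A * P B)%E.

(* sigma(f) *)
Definition sigma_fun d d' (T : measurableType d) (T' : measurableType d')
    (f : T -> T') : set (set T) :=
  preimage_set_system setT f measurable.

(* sigma(X_s, s in J) *)
Definition sigma_process d (T : measurableType d) (R : realType)
    (X : R -> T -> R) (J : set R) : set (set T) :=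
  <<s \bigcup_(s in J) sigma_fun (X s) >>.

(* Processes are indexed by all of R, but only times t >= 0 are constrained
   or used. *)
Record levy_process d (T : measurableType d) (R : realType)
    (P : probability T R) (X : R -> {RV P >-> R}) : Prop := {
  levy_start : forall w, X 0 w = 0 ;
  levy_right_continuous : forall w t, 0 <= t ->
    X s w @[s --> t^'+] --> X t w ;
  levy_left_limits : forall w t, 0 < t -> cvg (X s w @[s --> t^'-]) ;
  levy_independent_increments : forall s t, 0 <= s -> s <= t ->
    independent_systems P (sigma_process (fun u => X u) `[0, s])
                          (sigma_fun (X t \- X s : T -> R)) ;
  levy_stationary_increments : forall s t, 0 <= s -> s <= t ->
    forall A : set R, measurable A ->
    pushforward P (X t \- X s : T -> R) A = distribution P (X (t - s)) A }.

Record subordinator d (T : measurableType d) (R : realType)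
    (P : probability T R) (X : R -> {RV P >-> R}) : Prop := {
  subordinator_levy : levy_process X ;
  subordinator_ge0 : forall w t, 0 <= t -> 0 <= X t w }.

(* An exponential time of rate kappa; it is identically +oo when kappa = 0. *)
Definition exponential_time d (T : measurableType d) (R : realType)
    (P : probability T R) (kappa : R) (e : T -> \bar R) : Prop :=
  if kappa == 0 then forall w, e w = +oo%E
  else exists tau : {RV P >-> R},
    (forall w, e w = (tau w)%:E) /\
    forall A : set R, measurable A ->
      distribution P tau A = exponential_prob kappa A.

(* X is the unkilled subordinator, e the killing time, and phi the Laplace
   exponent of X killed at e.  From time e on the killed process sits at a
   cemetery state where exp(- u * _) is 0, for u = 0 too: this is what makes
   phi 0 = kappa, and it is why the integral below runs over [t < e] only.
   The values of phi at negative arguments are irrelevant. *)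
Record killed_subordinator d (T : measurableType d) (R : realType)
    (P : probability T R) (X : R -> {RV P >-> R}) (kappa : R)
    (e : T -> \bar R) (phi : R -> R) : Prop := {
  killed_subordinator_unkilled : subordinator X ;
  killed_time : exponential_time P kappa e ;
  killed_independent :
    independent_systems P (sigma_process (fun u => X u) `[0, +oo[)
                          (sigma_fun e) ;
  killed_laplace : forall u t, 0 <= u -> 0 <= t ->
    (\int[P]_(w in [set w | (t%:E < e w)%E]) (expR (- u * X t w))%:E =
     (expR (- phi u * t))%:E)%E }.

(* int_0^e exp(- X_s) ds *)
Definition exp_functional d (T : measurableType d) (R : realType)
    (X : R -> T -> R) (e : T -> \bar R) (w : T) : \bar R :=
  (\int[lebesgue_measure]_(s in [set s : R | (0 <= s)%R /\ s%:E < e w])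
     (expR (- X s w))%:E)%E.

(* The case beta = 0 is split off because u / (u + beta) is 0 in MathComp for
   u = beta = 0, whereas phi 0 may be nonzero. *)
Definition T_transform (R : realType) (beta : R) (phi : R -> R) (u : R) : R :=
  if beta == 0 then phi u else u / (u + beta) * phi (u + beta).

(* Main.v *)
Require Import Defs.
From HB Require Import structures.
From mathcomp Require Import all_boot all_order all_algebra.
From mathcomp Require Import all_classical all_reals all_analysis.
From mathcomp Require Import measurable_realfun.
From mathcomp Require Import ring lra.

(** The laws of the two exponential functionals are compared through their
    integer moments.  Expanding I^n as n! times an integral over ordered times
    (iterated_tail_pow) and integrating out the times from the last to the
    first, with the Markov property at each of them (markov_step), gives
    E[I^n] = n! / (phi 1 * ... * phi n) (exp_functional_moment).  As phi is
    nondecreasing and positive on the positive half-line, this is at most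
    n! / (phi 1)^n, and a measure on the half-line whose moments satisfy such
    a bound is determined by them (eq_measure_of_moments).

    The moments of the law of I with density x^beta are the E[I^(beta + n)].
    The recurrence E[I^(q + 1)] = (q + 1) / phi (q + 1) * E[I^q], for every
    real q >= 0 (power_moment_recurrence), computes them up to the factor
    E[I^beta], and since T_beta phi k = k / (k + beta) * phi (k + beta), what
    comes out is n! / (T_beta phi 1 * ... * T_beta phi n), the moment of the
    exponential functional of T_beta phi.

    The recurrence for real q usually comes from splitting the path at a time
    r, I = int_0^r e^(- X_s) ds + e^(- X_r) I~.  Here the case of integer q
    suffices: it says that the finite measure P(I > z) dz and the image of
    e^(- X_r(w)) 1_{r < e(w)} dr P(dw) P(dw') under the map
    (r, w, w') -> e^(- X_r(w)) I(w') have the same integer moments.  These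
    grow slowly enough, so that the two measures are equal, and the integral
    of z^q against them gives the recurrence for q. *)

Set Implicit Arguments.
Unset Strict Implicit.
Unset Printing Implicit Defensive.

Import Order.TTheory GRing.Theory Num.Theory.
Import numFieldNormedType.Exports.

Local Open Scope classical_set_scope.
Local Open Scope ring_scope.

(** * Integrals of indicators and comparison sets *)

Lemma integral_indicMl d (T : measurableType d) (R : realType)
    (mu : {measure set T -> \bar R}) (A : set T) (f : T -> \bar R) :
  (\int[mu]_x ((\1_A x)%:E * f x) = \int[mu]_(x in A) f x)%E.
Proof.
rewrite [RHS]integral_mkcond; apply: eq_integral => x _.
by rewrite epatch_indic muleC.
Qed.

Lemma measurable_ler_set d (T : measurableType d) (R : realType) (f g : T -> R) :
  measurable_fun setT f -> measurable_fun setT g ->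
  measurable [set x | f x <= g x].
Proof.
move=> mf mg; have := measurable_fun_ler mf mg.
move=> /(_ measurableT [set true]); rewrite setTI.
rewrite (_ : _ @^-1` _ = [set x | f x <= g x]); first by apply.
by apply/seteqP; split => x /=; case: (f x <= g x).
Qed.

(** * Functions with the same integral for two measures *)

Section agreement.
Context (R : realType).
Variables m1 m2 : {measure set (measurableTypeR R) -> \bar R}.
Local Notation D := (`[0, +oo[%classic : set (measurableTypeR R)).

(** Integrability is part of the notion, so that these functions form a vector
    space closed under dominated limits. *)
Definition agree (f : R -> R) := [/\ m1.-integrable D (EFin \o f),
  m2.-integrable D (EFin \o f) &
  (\int[m1]_(x in D) (f x)%:E = \int[m2]_(x in D) (f x)%:E)%E].

Let mD : measurable D. Proof. exact: measurable_itv. Qed.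

Lemma eq_agree f g : {in D, f =1 g} -> agree f -> agree g.
Proof.
move=> fg [i1 i2 e]; have fg' : {in D, EFin \o f =1 EFin \o g}.
  by move=> x xD /=; rewrite fg.
split; [exact: eq_integrable i1 | exact: eq_integrable i2 |].
by rewrite -(eq_integral _ _ fg') e; exact: eq_integral.
Qed.

Lemma agreeD f g : agree f -> agree g -> agree (fun x => f x + g x).
Proof.
move=> [f1 f2 fe] [g1 g2 ge]; split.
- exact: integrableD f1 g1.
- exact: integrableD f2 g2.
- by rewrite (integralD_EFin _ f1 g1)// (integralD_EFin _ f2 g2)// fe ge.
Qed.

Lemma agreeZ k f : agree f -> agree (fun x => k * f x).
Proof.
move=> [f1 f2 fe]; split.
- exact: (integrableZl mD k f1).
- exact: (integrableZl mD k f2).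
- under eq_integral do rewrite EFinM.
  under [RHS]eq_integral do rewrite EFinM.
  by rewrite !integralZl// fe.
Qed.

Lemma agreeB f g : agree f -> agree g -> agree (fun x => f x - g x).
Proof.
move=> af /(agreeZ (-1)) ag; apply: eq_agree (agreeD af ag) => x _.
by rewrite mulN1r.
Qed.

Lemma agree_sum (f : nat -> R -> R) n : (forall k, agree (f k)) ->
  agree (fun x => \sum_(k < n) f k x).
Proof.
move=> af; elim: n => [|n ih].
  apply: (eq_agree _ (agreeZ 0 (af 0))) => x _.
  by rewrite mul0r big_ord0.
apply: eq_agree (agreeD ih (af n)) => x _.
by rewrite big_ord_recr.
Qed.

Lemma agree_lim (f_ : nat -> R -> R) (f g : R -> R) :
  (forall n, agree (f_ n)) ->
  m1.-integrable D (EFin \o g) -> m2.-integrable D (EFin \o g) ->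
  (forall n x, 0 <= x -> `|f_ n x| <= g x) ->
  (forall x, 0 <= x -> f_ ^~ x @ \oo --> f x) -> agree f.
Proof.
move=> af g1 g2 fg flim.
have D0 x : D x -> 0 <= x by rewrite /= in_itv/= andbT.
have mf_ n : measurable_fun D (f_ n).
  by have [/integrableP[/measurable_EFinP]] := af n.
have mf : measurable_fun D f.
  by apply: (measurable_fun_cvg mf_) => x /D0; exact: flim.
have DC (m : {measure set (measurableTypeR R) -> \bar R}) :
    m.-integrable D (EFin \o g) ->
    m.-integrable D (EFin \o f) /\
    (fun n => \int[m]_(x in D) (f_ n x)%:E)%E @ \oo -->
      (\int[m]_(x in D) (f x)%:E)%E.
  move=> ig; have [] := @dominated_convergence _ _ _ m D mD
    (fun n => EFin \o f_ n) (EFin \o f) (EFin \o g) _ _ _ ig _.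
  - by move=> n; apply/measurable_EFinP.
  - exact/measurable_EFinP.
  - apply: aeW => x /D0 x0; apply/cvg_EFin; last exact: flim.
    by apply: nearW.
  - by apply: aeW => x n /D0 x0; rewrite /= lee_fin fg.
  - by move=> ? _ ?; split.
have [i1 l1] := DC m1 g1; have [i2 l2] := DC m2 g2; split => //.
apply: (cvg_unique _ l1); first exact: ereal_hausdorff.
suff -> : (fun n => \int[m1]_(x in D) (f_ n x)%:E)%E =
  (fun n => \int[m2]_(x in D) (f_ n x)%:E)%E by [].
by apply/funext => n; have [] := af n.
Qed.

End agreement.

(** * Exponential series and exponential moments *)

Section exponential_series.
Context (R : realType).
Implicit Types x y : R.

Lemma series_exp_coeff_le y n : 0 <= y -> series (exp_coeff y) n <= expR y.
Proof.
move=> y0; apply: nondecreasing_cvgn_le; last exact: is_cvg_series_exp_coeff.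
by apply: nondecreasing_series => k _ _; exact: exp_coeff_ge0.
Qed.

Lemma exprn_le_expR y n : 0 <= y -> y ^+ n <= n`!%:R * expR y.
Proof.
move=> y0; rewrite mulrC -ler_pdivrMr ?ltr0n ?fact_gt0//.
case: n => [|n]; last by apply: le_trans (expR_ge1Dxn n y0); rewrite lerDr.
by rewrite expr0 fact0 divr1; apply: le_trans (expR_ge1Dx y); rewrite lerDl.
Qed.

Lemma norm_series_exp_coeff_le x n :
  `|series (exp_coeff x) n| <= expR `|x|.
Proof.
apply: le_trans (series_exp_coeff_le n (normr_ge0 x)).
rewrite /series/=; apply: le_trans (ler_norm_sum _ _ _) _.
by apply: ler_sum => k _; rewrite /exp_coeff/= normrM normrX normfV normr_nat.
Qed.

End exponential_series.

Section exponential_moments.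
Context (R : realType) (m : {measure set (measurableTypeR R) -> \bar R}).
Local Notation D := (`[0, +oo[%classic : set (measurableTypeR R)).
Variables (C M : R).
Hypothesis M0 : 0 < M.
Hypothesis moments_le : forall n,
  (\int[m]_(x in D) (x ^+ n)%:E <= (C * M ^+ n * n`!%:R)%:E)%E.

Let mD : measurable D. Proof. exact: measurable_itv. Qed.
Let D0 (x : R) : D x -> 0 <= x. Proof. by rewrite /= in_itv/= andbT. Qed.
Let m_expR (c : R) : measurable_fun D (fun x : R => expR (c * x)).
Proof.
apply: measurableT_comp; first exact: measurable_expR.
exact: mulrl_measurable.
Qed.

(** Integrating the exponential series term by term bounds the integral by
    C * (1 + 1/2 + 1/4 + ...). *)
Lemma exp_moment_finite :
  m.-integrable D (fun x => (expR ((2 * M)^-1 * x))%:E).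
Proof.
set c := (2 * M)^-1.
have c0 : 0 < c by rewrite invr_gt0 mulr_gt0.
apply/integrableP; split; first exact/measurable_EFinP.
under eq_integral do rewrite gee0_abs ?lee_fin ?expR_ge0//.
have C0 : 0 <= C.
  have := le_trans (integral_ge0 _ _) (moments_le 0); rewrite lee_fin.
  by rewrite expr0 fact0 !mulr1; apply=> x _; rewrite expr0 lee_fin.
pose g n (x : R) := (series (exp_coeff (c * x)) n)%:E.
have g0 n x : D x -> (0 <= g n x)%E.
  move=> /D0 x0; rewrite lee_fin sumr_ge0// => k _; rewrite exp_coeff_ge0//.
  by rewrite mulr_ge0// ltW.
have mX n : measurable_fun D (fun x : R => (x ^+ n)%:E).
  by apply/measurable_EFinP; exact: exprn_measurable.
have gE n x : g n x = (\sum_(0 <= k < n) (c ^+ k / k`!%:R)%:E * (x ^+ k)%:E)%E.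
  rewrite /g /series/= sumEFin; congr EFin.
  by apply: eq_bigr => k _; rewrite /exp_coeff/= exprMn mulrAC.
have mg n : measurable_fun D (g n).
  by rewrite (funext (gE n)); apply: emeasurable_sum => k; exact: measurable_funeM.
have gnd x : D x -> {homo g^~ x : n p / (n <= p)%N >-> (n <= p)%E}.
  move=> /D0 x0 n p np; rewrite lee_fin.
  apply: (nondecreasing_series (P := xpredT)) np => k _ _.
  by rewrite exp_coeff_ge0// mulr_ge0// ltW.
have cvg_g : (\int[m]_(x in D) g n x)%E @[n --> \oo] -->
    (\int[m]_(x in D) (expR (c * x))%:E)%E.
  rewrite [X in _ --> X](_ : _ = \int[m]_(x in D) limn (g ^~ x))%E.
    exact: cvg_monotone_convergence.
  apply: eq_integral => x xD; apply/esym/cvg_lim => //.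
  apply: cvg_EFin; first exact: nearW.
  exact: is_cvg_series_exp_coeff.
rewrite -(cvg_lim _ cvg_g)//; apply: (@le_lt_trans _ _ (C * 2)%:E);
  last exact: ltry.
apply: lime_le; first exact: cvgP cvg_g.
apply: nearW => n.
under eq_integral do rewrite gE.
have ck0 k : (0 <= (c ^+ k / k`!%:R)%:E)%E.
  by rewrite lee_fin divr_ge0// exprn_ge0// ltW.
rewrite ge0_integral_sum//; last 2 first.
  - by move=> k; exact: measurable_funeM.
  - by move=> k x /D0 x0; rewrite mule_ge0// lee_fin exprn_ge0.
apply: (@le_trans _ _ (\sum_(0 <= k < n) (C * 2^-1 ^+ k)%:E)%E).
  apply: lee_sum => k _; rewrite ge0_integralZl//; last first.
    by move=> x /D0 x0; rewrite lee_fin exprn_ge0.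
  apply: le_trans (lee_wpmul2l _ (moments_le k)) _ => //.
  rewrite -EFinM lee_fin /c invfM exprMn.
  rewrite le_eqVlt; apply/orP; left; apply/eqP.
  have Mk : M ^+ k != 0 by rewrite expf_neq0// gt_eqF.
  have kf : (k`!%:R : R) != 0 by rewrite pnatr_eq0 -lt0n fact_gt0.
  have k2 : (2 ^+ k : R) != 0 by rewrite expf_neq0.
  by rewrite !exprVn; field; rewrite Mk kf k2.
rewrite sumEFin lee_fin.
have -> : \sum_(0 <= k < n) C * 2^-1 ^+ k = series (geometric C 2^-1) n by [].
apply: le_trans (geometric_le_lim n C0 _ _) _ => //.
  by rewrite ger0_norm ?invr_ge0// invf_lt1// ltr1n.
by rewrite (_ : (1 - 2^-1)^-1 = 2 :> R)//; field.
Qed.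

(** Half of the exponential rate absorbs any power. *)
Lemma exp_pow_moment_finite n :
  m.-integrable D (fun x => (x ^+ n * expR ((4 * M)^-1 * x))%:E).
Proof.
set c := (4 * M)^-1.
have c0 : 0 < c by rewrite invr_gt0 mulr_gt0.
have i := integrableZl mD (n`!%:R * c ^- n) exp_moment_finite.
apply: (le_integrable mD _ _ i).
  apply/measurable_EFinP; apply: measurable_funM => //.
move=> x /D0 x0.
rewrite -EFinM !gee0_abs ?lee_fin; last 2 first.
- by rewrite mulr_ge0 ?expR_ge0// mulr_ge0// invr_ge0 exprn_ge0// ltW.
- by rewrite mulr_ge0 ?expR_ge0// exprn_ge0.
have -> : (2 * M)^-1 * x = c * x + c * x.
  by rewrite /c; field; rewrite gt_eqF.
rewrite expRD mulrA ler_wpM2r ?expR_ge0//.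
rewrite mulrAC ler_pdivlMr ?exprn_gt0// -exprMn mulrC.
by rewrite -(mulrC x); apply: exprn_le_expR; rewrite mulr_ge0// ltW.
Qed.

End exponential_moments.

(** * Exponential polynomials converging to the indicator of a ray *)

Section threshold.
Context (R : realType).
Implicit Types x y c : R.

Lemma bernoulli_ineq x n : -1 <= x -> 1 + n%:R * x <= (1 + x) ^+ n.
Proof.
move=> x1; elim: n => [|n ih]; first by rewrite mul0r addr0 expr0.
have x10 : 0 <= 1 + x by rewrite -lerBlDl sub0r.
rewrite exprS; apply: le_trans (ler_wpM2l x10 ih).
rewrite -subr_ge0 (_ : _ - _ = n%:R * x ^+ 2).
  by rewrite mulr_ge0// sqr_ge0.
by rewrite -natr1; ring.
Qed.

(** With z = expR (- t * y), this is (1 - z ^ n) ^ (n * 2 ^ n), which is at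
    least 1 - n * (2 * z) ^ n when 2 * z < 1 and at most 1 / (n + 1) when
    2 * z >= 1.  The factor n in the exponent forces the limit 0 at 2 * z = 1,
    where the exponent 2 ^ n would give exp (-1): the endpoint of the ray may
    be an atom, so that the limit has to be its indicator everywhere. *)
Definition threshold (t : R) n y :=
  (1 - expR (- (t * n%:R) * y)) ^+ (n * 2 ^ n).

Let expR_itv t n y : 0 <= t -> 0 <= y -> 0 <= expR (- (t * n%:R) * y) <= 1.
Proof.
move=> t0 y0; rewrite expR_ge0/= -expR0 ler_expR mulNr oppr_le0.
by rewrite !mulr_ge0.
Qed.

Lemma threshold_itv t n y : 0 <= t -> 0 <= y -> 0 <= threshold t n y <= 1.
Proof.
move=> t0 y0; have /andP[e0 e1] := expR_itv n t0 y0.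
by rewrite exprn_ge0 ?subr_ge0//= exprn_ile1 ?subr_ge0 ?gerBl.
Qed.

Let threshold_exponent t n y :
  (n * 2 ^ n)%N%:R * expR (- (t * n%:R) * y) = n%:R * expR ((ln 2 - t * y) * n%:R).
Proof.
rewrite natrM natrX -[X in X ^+ n](@lnK _ (2 : R)) ?posrE//.
by rewrite -expRM_natr -mulrA -expRD; congr (_ * expR _); ring.
Qed.

Lemma threshold_cvg1 t y : 0 <= t -> 0 <= y -> ln 2 < t * y ->
  threshold t ^~ y @ \oo --> (1 : R).
Proof.
move=> t0 y0 ty; pose c := t * y - ln 2.
have c0 : 0 < c by rewrite subr_gt0.
apply: (@squeeze_cvgr _ _ _ _ (fun n => 1 - 2 / c ^+ 2 * n%:R^-1) (fun=> 1)).
- near=> n.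
  have /andP[e0 e1] := expR_itv n t0 y0.
  have /andP[_ ->] := threshold_itv n t0 y0; rewrite andbT.
  (* n * exp (- c * n) <= 2 / (c ^ 2 * n), by the quadratic term of exp. *)
  apply: (@le_trans _ _ (1 - (n * 2 ^ n)%N%:R * expR (- (t * n%:R) * y))).
    have n0 : (0 < n%:R :> R) by rewrite ltr0n; near: n; exact: nbhs_infty_gt.
    rewrite lerD2l lerN2 threshold_exponent -opprB -/c mulNr expRN.
    have := @exprn_le_expR _ (c * n%:R) 2 _; rewrite mulr_ge0 ?(ltW c0)//.
    move=> /(_ isT); rewrite (_ : 2`!%:R = 2 :> R)// => h.
    rewrite ler_pdivrMr ?expR_gt0// mulrAC -(mulrC (expR _)).
    rewrite -[leLHS]mul1r.
    rewrite -(@ler_pM2l _ (c ^+ 2 * n%:R)) ?mulr_gt0 ?exprn_gt0//.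
    rewrite (_ : _ * (1 * n%:R) = (c * n%:R) ^+ 2); last by ring.
    apply: le_trans h _.
    rewrite le_eqVlt; apply/orP; left; apply/eqP.
    by field; rewrite !gt_eqF.
  rewrite -mulrN; apply: bernoulli_ineq; by rewrite lerN2.
- rewrite -[X in _ --> X]subr0; apply: cvgB; first exact: cvg_cst.
  rewrite -[X in _ --> X](mulr0 (2 / c ^+ 2)); apply: cvgMr.
  by rewrite -cvg_shiftS; exact: cvg_harmonic.
- exact: cvg_cst.
Unshelve. all: by end_near. Qed.

Lemma threshold_cvg0 t y : 0 <= t -> 0 <= y -> t * y <= ln 2 ->
  threshold t ^~ y @ \oo --> (0 : R).
Proof.
move=> t0 y0 ty.
apply: (@squeeze_cvgr _ _ _ _ (fun=> 0) (fun n => (n.+1%:R)^-1)).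
- apply: nearW => n.
  have /andP[e0 e1] := expR_itv n t0 y0.
  have /andP[-> _] := threshold_itv n t0 y0; rewrite /=.
  rewrite -[leRHS]mul1r ler_pdivlMr ?ltr0n//.
  (* (1 - x) ^ m * (1 + m * x) <= (1 - x) ^ m * (1 + x) ^ m <= 1, where m * x
     is at least n. *)
  apply: (@le_trans _ _ (threshold t n y *
      (1 + expR (- (t * n%:R) * y)) ^+ (n * 2 ^ n))).
    rewrite ler_wpM2l//; first by have /andP[] := threshold_itv n t0 y0.
    apply: le_trans (bernoulli_ineq _ _); last by apply: le_trans e0; lra.
    rewrite threshold_exponent -natr1 addrC lerD2l ler_peMr//.
    by rewrite -[leLHS]expR0 ler_expR mulr_ge0// subr_ge0.
  rewrite -exprMn exprn_ile1//.
    by rewrite mulr_ge0 ?subr_ge0// addr_ge0.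
  by rewrite -subr_sqr expr1n gerBl sqr_ge0.
- exact: cvg_cst.
- exact: cvg_harmonic.
Qed.

End threshold.

(** * Measures with slowly growing moments are determined by them *)

Section determinacy.
Context (R : realType).
Variables m1 m2 : {measure set (measurableTypeR R) -> \bar R}.
Local Notation D := (`[0, +oo[%classic : set (measurableTypeR R)).
Variables (C M : R).
Hypothesis M0 : 0 < M.
Hypothesis moments_eq : forall n,
  (\int[m1]_(x in D) (x ^+ n)%:E = \int[m2]_(x in D) (x ^+ n)%:E)%E.
Hypothesis moments_le : forall n,
  (\int[m1]_(x in D) (x ^+ n)%:E <= (C * M ^+ n * n`!%:R)%:E)%E.

Let mD : measurable D. Proof. exact: measurable_itv. Qed.
Let D0 (x : R) : D x -> 0 <= x. Proof. by rewrite /= in_itv/= andbT. Qed.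
Let moments_le2 n :
  (\int[m2]_(x in D) (x ^+ n)%:E <= (C * M ^+ n * n`!%:R)%:E)%E.
Proof. by rewrite -moments_eq. Qed.

Let agree_pow n : agree m1 m2 (fun x => x ^+ n).
Proof.
have mX : measurable_fun D (fun x : R => (x ^+ n)%:E).
  by apply/measurable_EFinP; exact: exprn_measurable.
split => //; apply/integrableP; split => //.
- under eq_integral => x xD.
    rewrite gee0_abs; first over.
    by rewrite lee_fin exprn_ge0// D0//; rewrite inE in xD.
  by apply: le_lt_trans (moments_le n) _; rewrite ltry.
- under eq_integral => x xD.
    rewrite gee0_abs; first over.
    by rewrite lee_fin exprn_ge0// D0//; rewrite inE in xD.
  by apply: le_lt_trans (moments_le2 n) _; rewrite ltry.
Qed.

(** Expanding expR (- h * x) in a power series turns moments against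
    expR (- t * x) into moments against expR (- (t + h) * x).  The step h that is
    allowed does not depend on t, because the density expR (- t * x) is at
    most 1; hence every t is reached in finitely many steps. *)
Let agree_shift t h : 0 <= t -> 0 <= h <= (4 * M)^-1 ->
  (forall n, agree m1 m2 (fun x => x ^+ n * expR (- t * x))) ->
  forall n, agree m1 m2 (fun x => x ^+ n * expR (- (t + h) * x)).
Proof.
move=> t0 /andP[h0 hM] agree_t n.
pose f N (x : R) := \sum_(k < N) ((- h) ^+ k / k`!%:R) *
  (x ^+ (n + k) * expR (- t * x)).
have fE N x : f N x = x ^+ n * expR (- t * x) * series (exp_coeff (- h * x)) N.
  rewrite /f /series/= big_mkord mulr_sumr; apply: eq_bigr => k _.
  rewrite /exp_coeff/= exprD exprMn; ring.
apply: (@agree_lim _ _ _ f _ (fun x => x ^+ n * expR ((4 * M)^-1 * x))).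
- move=> N; apply: (@agree_sum _ _ _ (fun k x =>
    ((- h) ^+ k / k`!%:R) * (x ^+ (n + k) * expR (- t * x)))) => k.
  exact: agreeZ.
- exact: (exp_pow_moment_finite M0 moments_le n).
- exact: (exp_pow_moment_finite M0 moments_le2 n).
- move=> N x x0; rewrite fE !normrM normrX (ger0_norm x0) -mulrA.
  rewrite ler_wpM2l ?exprn_ge0// (ger0_norm (expR_ge0 _)) -[leRHS]mul1r.
  apply: ler_pM => //.
    by rewrite -expR0 ler_expR mulNr oppr_le0 mulr_ge0.
  apply: le_trans (norm_series_exp_coeff_le _ _) _.
  by rewrite ler_expR mulNr normrN normrM !ger0_norm// ler_wpM2r.
- move=> x x0.
  rewrite (_ : x ^+ n * _ = x ^+ n * expR (- t * x) * expR (- h * x)); last first.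
    by rewrite opprD mulrDl expRD mulrA.
  under eq_cvg do rewrite fE.
  by apply: cvgMr; exact: is_cvg_series_exp_coeff.
Qed.

Lemma agree_laplace t : 0 <= t -> agree m1 m2 (fun x => expR (- t * x)).
Proof.
move=> t0; pose K := Num.bound (t * (4 * M)).
have tK : t * (4 * M) < K%:R by rewrite archi_boundP// mulr_ge0// mulr_ge0// ltW.
have K0 : (0 < K%:R :> R) by apply: le_lt_trans tK; rewrite !mulr_ge0// ltW.
pose h := t / K%:R.
have h0 : 0 <= h by rewrite divr_ge0// ltW.
have hM : h <= (4 * M)^-1.
  by rewrite /h ler_pdivrMr// mulrC ler_pdivlMr ?mulr_gt0// ltW.
have step k : forall n, agree m1 m2 (fun x => x ^+ n * expR (- (k%:R * h) * x)).
  elim: k => [n|k ih].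
    apply: eq_agree (agree_pow n) => x _.
    by rewrite mul0r oppr0 mul0r expR0 mulr1.
  move=> n; rewrite -natr1 mulrDl mul1r; apply: agree_shift => //.
    by rewrite mulr_ge0.
  by rewrite h0.
apply: eq_agree (step K 0%N) => x _.
by rewrite expr0 mul1r /h mulrCA divff ?mulr1 ?gt_eqF.
Qed.

Lemma agree_laplace_poly s k n : 0 <= s ->
  agree m1 m2 (fun x => (1 - expR (- s * x)) ^+ n * expR (- s * x) ^+ k).
Proof.
move=> s0; elim: n k => [|n ih] k.
  have sk : 0 <= s * k%:R by rewrite mulr_ge0.
  apply: eq_agree (agree_laplace sk) => x _.
  by rewrite expr0 mul1r -expRM_natr; congr expR; ring.
apply: eq_agree (agreeB (ih k) (ih k.+1)) => x _.
by rewrite !exprS; ring.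
Qed.

Let agree_ray_gt0 a : 0 < a -> agree m1 m2 \1_(`]a, +oo[%classic : set R).
Proof.
move=> a0; pose t := ln 2 / a.
have t0 : 0 <= t by rewrite divr_ge0 ?ltW// ln_gt0// ltr1n.
have [i1 i2 _] := agree_pow 0.
apply: (@agree_lim _ _ _ (threshold t) _ (fun=> 1)) => //.
- move=> n; have tn : 0 <= t * n%:R by rewrite mulr_ge0.
  apply: eq_agree (agree_laplace_poly 0 (n * 2 ^ n) tn) => x _.
  by rewrite expr0 mulr1.
- move=> n x x0; have /andP[? ?] := threshold_itv n t0 x0.
  by rewrite ger0_norm.
- move=> x x0; rewrite indicE.
  have ta : t * a = ln 2 by rewrite divfK// gt_eqF.
  have tgt0 : 0 < t by rewrite divr_gt0// ln_gt0// ltr1n.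
  have [ax|xa] := ltP a x.
    rewrite mem_set/=; last by rewrite in_itv/= ax.
    by apply: threshold_cvg1 => //; rewrite -ta ltr_pM2l.
  rewrite memNset/=; last by rewrite in_itv/= andbT; apply/negP; rewrite -leNgt.
  by apply: threshold_cvg0 => //; rewrite -ta ler_pM2l.
Qed.

Let agree_ray a : 0 <= a -> agree m1 m2 \1_(`]a, +oo[%classic : set R).
Proof.
rewrite le_eqVlt => /predU1P[<-|]; last exact: agree_ray_gt0.
have [i1 i2 _] := agree_pow 0.
apply: (@agree_lim _ _ _ (fun n => \1_(`]n.+1%:R^-1, +oo[%classic : set R)) _
  (fun=> 1)) => //.
- by move=> n; apply: agree_ray_gt0; rewrite invr_gt0.
- by move=> n x x0; rewrite indicE; case: (_ \in _); rewrite ?normr1 ?normr0.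
- move=> x; rewrite le_eqVlt => /predU1P[<-|x0].
    rewrite (_ : (fun _ => _) = (fun=> \1_(`]0, +oo[%classic : set R) 0)).
      exact: cvg_cst.
    apply/funext => n; rewrite !indicE !memNset//= in_itv/= andbT ?ltxx//.
    by apply/negP; rewrite -leNgt invr_ge0.
  apply: cvg_near_cst; near=> n.
  rewrite !indicE !mem_set//= in_itv/= andbT//.
  near: n; exact: near_infty_natSinv_lt (PosNum x0).
Unshelve. all: by end_near. Qed.

(** The Laplace transforms agree, hence so do the integrals of polynomials in
    expR (- s * x), and by bounded convergence the measures of all rays. *)
Lemma eq_measure_of_moments (A : set (measurableTypeR R)) :
  measurable A -> A `<=` D -> m1 A = m2 A.
Proof.
move=> mA AD.
have eqD : m1 D = m2 D.
  have [_ _] := agree_pow 0; under eq_integral do rewrite expr0.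
  under [in X in _ = X]eq_integral do rewrite expr0.
  by rewrite !integral_cst// !mul1e.
have m1D : (m1 D < +oo)%E.
  have [/integrableP[_]] := agree_pow 0.
  under eq_integral do rewrite /= expr0 normr1.
  by rewrite integral_cst// mul1e.
suff : mrestr m1 mD A = mrestr m2 mD A by rewrite /mrestr !(setIidl AD).
apply: (@measure_unique _ R (measurableTypeR R) (@RGenOInfty.G R)
  (fun n => `](- n%:R), +oo[%classic) _ _ _ _ (mrestr m1 mD) (mrestr m2 mD)) => //.
- exact: RGenOInfty.measurableE.
- move=> _ _ [a ->] [b ->]; exists (Num.max a b).
  by apply/seteqP; split => x /=; rewrite !in_itv/= !andbT gt_max => /andP.
- by move=> n; exists (- n%:R).
- rewrite -subTset => x _; exists (Num.bound `|x|) => //=.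
  rewrite in_itv/= andbT ltrNl.
  by apply: le_lt_trans (archi_boundP _) => //; rewrite -normrN ler_norm.
- move=> _ [a ->]; rewrite /mrestr.
  have [a0|a0] := leP 0 a.
    have [_ _] := agree_ray a0; rewrite !integral_indic//.
  have aD : `]a, +oo[ `&` D = D.
    apply: setIidr => x /D0 x0; rewrite /= in_itv/= andbT; exact: lt_le_trans x0.
  by rewrite /= /mrestr aD.
- move=> n; rewrite /= /mrestr; apply: le_lt_trans m1D.
  by apply: le_measure; rewrite ?inE//; apply: measurableI.
Qed.

End determinacy.

(** * The law of a function under a measure with a density *)

Section weighted_law.
Local Open Scope ereal_scope.
Context d (T : measurableType d) (R : realType) (mu : {measure set T -> \bar R}).
Variables (w Y : T -> R).
Hypotheses (mw : measurable_fun [set: T] w) (w0 : forall x, (0 <= w x)%R).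
Hypothesis mY : measurable_fun [set: T] Y.

(** The hypotheses are arguments so that the measure structure on the weighted
    law can be inferred from it. *)
Definition weighted_law of measurable_fun [set: T] w & (forall x, (0 <= w x)%R) &
    measurable_fun [set: T] Y := fun A : set (measurableTypeR R) =>
  \int[mu]_(x in Y @^-1` A) (w x)%:E.

Local Notation law := (weighted_law mw w0 mY).

Let mYpre (A : set (measurableTypeR R)) : measurable A -> measurable (Y @^-1` A).
Proof. by move=> mA; rewrite -[X in measurable X]setTI; exact: mY. Qed.

Let law0 : law set0 = 0.
Proof. by rewrite /weighted_law preimage_set0 integral_set0. Qed.

Let law_ge0 A : 0 <= law A.
Proof. by apply: integral_ge0 => x _; rewrite lee_fin. Qed.

Let law_semi_sigma_additive : semi_sigma_additive law.
Proof.
move=> F mF tF mUF; rewrite /weighted_law; apply: cvg_toP.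
  apply: ereal_nondecreasing_is_cvgn => m n mn.
  by apply: lee_sum_nneg_natr => // k _ _; apply: integral_ge0 => x _; rewrite lee_fin.
rewrite preimage_bigcup ge0_integral_bigcup//.
- by move=> k; exact: mYpre.
- by apply: measurable_funTS; exact/measurable_EFinP.
- by move=> x _; rewrite lee_fin.
- move=> i j _ _ [x [Fi Fj]]; by apply: tF => //; exists (Y x); split.
Qed.

HB.instance Definition _ := isMeasure.Build _ _ _ law
  law0 law_ge0 law_semi_sigma_additive.

Import HBNNSimple.

Let integral_law_nnsfun (h : {nnsfun (measurableTypeR R) >-> R}) :
  \int[law]_y (h y)%:E = \int[mu]_x ((h (Y x))%:E * (w x)%:E).
Proof.
have mh r : measurable (h @^-1` [set r]) by [].
have hY0 r x : 0 <= r%:E * (\1_(h @^-1` [set r]) (Y x))%:E.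
  exact: nnfun_muleindic_ge0.
have mhY1 r : measurable_fun setT (fun x => \1_(h @^-1` [set r]) (Y x) : R).
  have mi := @measurable_indic _ (measurableTypeR R) R setT _ (mh r).
  exact: (measurableT_comp mi mY).
have mhY r : measurable_fun setT (fun x => r%:E * (\1_(h @^-1` [set r]) (Y x))%:E).
  by apply: measurable_funeM; exact/measurable_EFinP.
transitivity (\int[mu]_x \sum_(r \in range h)
    (r%:E * (\1_(h @^-1` [set r]) (Y x))%:E * (w x)%:E)).
  rewrite ge0_integral_fsum//; last 2 first.
  - by move=> r; apply: emeasurable_funM; [exact: mhY|exact/measurable_EFinP].
  - by move=> r x _; rewrite mule_ge0// lee_fin.
  rewrite integralT_nnsfun sintegralE; apply: eq_fsbigr => r _.
  have [r0|r0] := leP 0%R r.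
    under eq_integral do rewrite -muleA.
    rewrite ge0_integralZl//; last 2 first.
    - apply: emeasurable_funM; exact/measurable_EFinP.
    - by move=> x _; rewrite mule_ge0// lee_fin.
    congr (_ * _).
    exact: (esym (integral_indicMl mu (Y @^-1` (h @^-1` [set r])) (EFin \o w))).
  rewrite preimage_nnfun0// measure0 mule0; under eq_integral do
    rewrite indicE in_set0 mule0 mul0e.
  by rewrite integral0.
apply: eq_integral => x _; rewrite -ge0_mule_fsuml//.
by congr (_ * _); rewrite (fimfunE h) -fsumEFin.
Qed.

Lemma ge0_integral_weighted_law (f : measurableTypeR R -> R) :
  measurable_fun setT f -> (forall y, (0 <= f y)%R) ->
  \int[law]_y (f y)%:E = \int[mu]_x ((f (Y x))%:E * (w x)%:E).
Proof.
move=> /measurable_EFinP mf f0; pose h := nnsfun_approx measurableT mf.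
have hf y : (fun n => (h n y)%:E) @ \oo --> (f y)%:E.
  by apply: cvg_nnsfun_approx => // z _; rewrite lee_fin.
have hnd y : {homo (fun n => (h n y)%:E) : n p / (n <= p)%N >-> n <= p}.
  by move=> n p np; rewrite lee_fin; exact/lefP/nd_nnsfun_approx.
transitivity (limn (fun n => \int[law]_y (h n y)%:E)).
  rewrite -monotone_convergence//.
  - by apply: eq_integral => y _; apply/esym/cvg_lim.
  - by move=> n; exact/measurable_EFinP.
  - by move=> n y _; rewrite lee_fin.
transitivity (limn (fun n => \int[mu]_x ((h n (Y x))%:E * (w x)%:E))).
  by congr (limn _); apply/funext => n; exact: integral_law_nnsfun.
rewrite -monotone_convergence//.
- apply: eq_integral => x _; apply/cvg_lim => //.
  by apply: cvgeM; [exact: mule_def_fin|exact: hf|exact: cvg_cst].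
- move=> n; apply: emeasurable_funM; apply/measurable_EFinP => //.
  exact: (measurableT_comp (@measurable_funPT _ _ _ _ (h n)) mY).
- by move=> n x _; rewrite mule_ge0// lee_fin.
- by move=> x _ n p np; apply: lee_wpmul2r; [rewrite lee_fin|exact: hnd].
Qed.

End weighted_law.

(** * Iterated tail integrals *)

Section iterated_tail.
Local Open Scope ereal_scope.
Context (R : realType).
Local Notation mu := (@lebesgue_measure R).
Implicit Types (a b g : R -> \bar R) (q r s : R).

Fixpoint iterated_tail g n q : \bar R :=
  if n is m.+1 then \int[mu]_(s in `[q, +oo[) (g s * iterated_tail g m s) else 1.

Lemma iterated_tail_ge0 g n q : (forall s, 0 <= g s) -> 0 <= iterated_tail g n q.
Proof.
move=> g0; elim: n q => [//|n ih] q; apply: integral_ge0 => s _.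
by rewrite mule_ge0.
Qed.

(** The parameter x.2 is the sample point when G is a process. *)
Lemma measurable_iterated_tail d (T : measurableType d) (G : R * T -> \bar R) n :
  measurable_fun setT G -> (forall x, 0 <= G x) ->
  measurable_fun setT (fun x => iterated_tail (fun s => G (s, x.2)) n x.1).
Proof.
move=> mG G0; elim: n => [|n ih]; first exact: measurable_cst.
pose J (x : R * T) := iterated_tail (fun s => G (s, x.2)) n x.1.
pose S : set ((R * T) * R) := [set z | (z.1.1 <= z.2)%R].
have mS : measurable S.
  apply: measurable_ler_set; last exact: measurable_snd.
  exact: (measurableT_comp measurable_fst measurable_fst).
pose F (z : (R * T) * R) := (\1_S z)%:E * (G (z.2, z.1.2) * J (z.2, z.1.2)).
have msw : measurable_fun setT (fun z : (R * T) * R => (z.2, z.1.2)).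
  apply: measurable_fun_pair; first exact: measurable_snd.
  exact: (measurableT_comp measurable_snd measurable_fst).
have mF : measurable_fun setT F.
  apply: emeasurable_funM.
    by apply/measurable_EFinP; exact: measurable_indic.
  by apply: emeasurable_funM; [exact: measurableT_comp|exact: measurableT_comp].
have F0 z : 0 <= F z.
  rewrite !mule_ge0// ?lee_fin//; apply: iterated_tail_ge0 => s; exact: G0.
have := @measurable_fun_fubini_tonelli_F _ _ _ _ R mu F mF F0.
apply: eq_measurable_fun => x _; rewrite /fubini_F /=.
rewrite [RHS]integral_mkcond; apply: eq_integral => s _.
rewrite epatch_indic/= muleC /F !indicE/=.
rewrite (_ : ((x, s) \in S) = (s \in `[x.1, +oo[%classic))//.
by apply/idP/idP; rewrite !inE /S/= in_itv/= andbT.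
Qed.

Let measurable_iterated_tail1 g n : measurable_fun setT g ->
  (forall s, 0 <= g s) -> measurable_fun setT (iterated_tail g n).
Proof.
move=> mg g0; have mG : measurable_fun setT (fun z : R * unit => g z.1).
  exact: measurableT_comp.
have := measurable_iterated_tail n mG (fun z => g0 z.1).
exact: (measurable_fun_pair1 tt).
Qed.

(** The square of pairs (r, s) of times after q is split according to which of
    the two comes first. *)
Lemma tail_mul a b q : measurable_fun setT a -> measurable_fun setT b ->
  (forall s, 0 <= a s) -> (forall s, 0 <= b s) ->
  (\int[mu]_(s in `[q, +oo[) a s) * (\int[mu]_(s in `[q, +oo[) b s) =
  \int[mu]_(r in `[q, +oo[) (a r * \int[mu]_(s in `[r, +oo[) b s) +
  \int[mu]_(s in `[q, +oo[) (b s * \int[mu]_(r in `[s, +oo[) a r).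
Proof.
move=> ma mb a0 b0.
have mtail (c : R -> \bar R) r : measurable_fun setT c -> measurable_fun `[r, +oo[ c.
  by move=> mc; exact: measurable_funTS.
rewrite -ge0_integralZr//; last 2 first.
- exact: mtail.
- by apply: integral_ge0.
(* For r >= q, the times s after q are those after r and those with (r, s) in
   S; exchanging the integrals turns S into the condition r > s. *)
pose S : set (R * R) := [set z | (q <= z.2)%R] `\` [set z | (z.1 <= z.2)%R].
have mS : measurable S.
  by apply: measurableD; apply: measurable_ler_set.
pose F (z : R * R) := (\1_S z)%:E * (a z.1 * b z.2).
have mF : measurable_fun setT F.
  apply: emeasurable_funM; first by apply/measurable_EFinP; exact: measurable_indic.
  by apply: emeasurable_funM; exact: measurableT_comp.
have F0 z : 0 <= F z by rewrite !mule_ge0// lee_fin.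
have mtl (c : R -> \bar R) : measurable_fun setT c -> (forall s, 0 <= c s) ->
    measurable_fun setT (fun r => \int[mu]_(s in `[r, +oo[) c s).
  move=> mc c0.
  have := measurable_iterated_tail1 1 mc c0.
  by apply: eq_measurable_fun => r _ /=; apply: eq_integral => s _; rewrite mule1.
transitivity (\int[mu]_(r in `[q, +oo[)
    (a r * (\int[mu]_(s in `[r, +oo[) b s) + \int[mu]_s F (r, s))).
  apply: eq_integral => r; rewrite inE/= in_itv/= andbT => qr.
  rewrite (_ : `[q, +oo[%classic = `[r, +oo[%classic `|` `[q, r[%classic);
    last by rewrite setUC -itv_bndbnd_setU// bnd_simp.
  rewrite ge0_integral_setU//=; last 2 first.
  - exact: measurable_funTS.
  - apply/disj_setPS => s /=; rewrite !in_itv/= andbT => -[rs /andP[_]].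
    by rewrite ltNge rs.
  rewrite ge0_muleDr ?integral_ge0//; congr (_ + _).
  rewrite -ge0_integralZl//; last exact: measurable_funTS.
  rewrite -integral_indicMl; apply: eq_integral => s _.
  rewrite /F !indicE; congr ((nat_of_bool _)%:R%:E * _).
  apply/idP/idP; rewrite !inE /S/= in_itv/=.
    by move=> /andP[-> sr]; split => //; apply/negP; rewrite -ltNge.
  by move=> [-> /negP]; rewrite -ltNge.
rewrite ge0_integralD//; last 4 first.
- by move=> r _; rewrite mule_ge0// integral_ge0.
- by apply: emeasurable_funM; apply: measurable_funTS => //; exact: mtl.
- by move=> r _; apply: integral_ge0.
- apply: measurable_funTS.
  exact: (@measurable_fun_fubini_tonelli_F _ _ _ _ R mu F mF F0).
congr (_ + _).
transitivity (\int[mu]_r \int[mu]_s F (r, s)).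
  rewrite integral_mkcond; apply: eq_integral => r _.
  rewrite patchE; case: ifPn => // rq; apply/esym/integral0_eq => s _.
  rewrite /F indicE memNset ?mul0e// => -[/= qs /negP]; rewrite -ltNge => sr.
  move/negP: rq; apply; rewrite inE/= in_itv/= andbT.
  exact: ltW (le_lt_trans qs sr).
rewrite (@fubini_tonelli _ _ _ _ R mu mu F mF F0) [RHS]integral_mkcond.
apply: eq_integral => s _.
rewrite patchE; case: ifPn => [|sq].
  rewrite inE/= in_itv/= andbT => qs.
  rewrite -integral_itv_obnd_cbnd; last exact: measurable_funTS.
  rewrite -ge0_integralZl//; last exact: measurable_funTS.
  rewrite -integral_indicMl; apply: eq_integral => r _.
  rewrite /F !indicE (muleC (a _)); congr ((nat_of_bool _)%:R%:E * _).
  apply/idP/idP; rewrite !inE /S/= in_itv/= andbT.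
    by move=> [_ /negP]; rewrite -ltNge.
  by move=> sr; split => //; apply/negP; rewrite -ltNge.
apply: integral0_eq => r _.
rewrite /F indicE memNset ?mul0e// => -[/= qs _].
by move/negP: sq; apply; rewrite inE/= in_itv/= andbT.
Qed.

(** A new time inserted into an ordered n-tuple falls into one of n + 1 gaps. *)
Lemma iterated_tail_mul g n q : measurable_fun setT g -> (forall s, 0 <= g s) ->
  iterated_tail g 1 q * iterated_tail g n q =
  n.+1%:R%:E * iterated_tail g n.+1 q.
Proof.
move=> mg g0.
have mJ k : measurable_fun setT (iterated_tail g k) by exact: measurable_iterated_tail1.
have mgJ k : measurable_fun setT (fun s => g s * iterated_tail g k s).
  exact: emeasurable_funM.
have J0 k s : 0 <= iterated_tail g k s by exact: iterated_tail_ge0.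
have gJ0 k s : 0 <= g s * iterated_tail g k s by rewrite mule_ge0.
elim: n q => [|n ih] q; first by rewrite mule1 mul1e.
rewrite [LHS]tail_mul//; [|exact: (mgJ 0%N)|exact: (gJ0 0%N)].
rewrite (_ : \int[mu]_(r in _) _ = iterated_tail g n.+2 q); last first.
  by apply: eq_integral => r _ /=; rewrite mule1.
under eq_integral => s _.
  rewrite -/(iterated_tail g 1 s) -muleA (muleC (iterated_tail g n s)) ih.
  rewrite muleCA; over.
rewrite ge0_integralZl//.
- by rewrite -[X in X + _]mul1e -ge0_muleDl// -EFinD nat1r.
- by apply: measurable_funTS; exact: mgJ.
Qed.

Lemma iterated_tail_pow g n q : measurable_fun setT g -> (forall s, 0 <= g s) ->
  iterated_tail g 1 q ^+ n = n`!%:R%:E * iterated_tail g n q.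
Proof.
move=> mg g0; elim: n => [|n ih]; first by rewrite expe0 fact0 mule1.
rewrite expeS ih muleCA iterated_tail_mul// muleA -EFinM -natrM.
by rewrite factS mulnC.
Qed.

End iterated_tail.

(** * Joint measurability of right-continuous processes *)

Section right_continuous_process.
Context (R : realType) d (T : measurableType d).

Lemma measurable_truncn_comp d' (S : measurableType d') (f : nat -> S -> R)
    (k : S -> R) :
  measurable_fun setT k -> (forall x, 0 <= k x) ->
  (forall n, measurable_fun setT (f n)) ->
  measurable_fun setT (fun x => f (Num.truncn (k x)) x).
Proof.
move=> mk k0 mf _ A mA; rewrite setTI.
rewrite (_ : _ @^-1` A = \bigcup_n
   (([set x | n%:R <= k x] `\` [set x | n.+1%:R <= k x]) `&` f n @^-1` A)).
  apply: bigcupT_measurable => n; apply: measurableI.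
    by apply: measurableD; apply: measurable_ler_set.
  by rewrite -[X in measurable X]setTI; exact: mf.
have trE x n : (Num.truncn (k x) == n) = (n%:R <= k x < n.+1%:R).
  exact: truncn_eq.
apply/seteqP; split => x /=.
  move=> Afx; exists (Num.truncn (k x)) => //; split => //.
  have := trE x (Num.truncn (k x)); rewrite eqxx => /esym/andP[? kx].
  by split => //; apply/negP; rewrite -ltNge.
move=> [n _ [[nk /negP]]]; rewrite -ltNge => kn /=.
by have /eqP -> : Num.truncn (k x) == n by rewrite trE nk.
Qed.

(** The path is the limit of its values at the times
    (floor (k * t) + 1) / k.  These lie strictly to the right of t, so right
    continuity suffices. *)
Lemma measurable_right_continuous_process (X : R -> T -> R) :
  (forall t, measurable_fun setT (X t)) ->
  (forall w t, 0 <= t -> X s w @[s --> t^'+] --> X t w) ->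
  measurable_fun setT (fun z : R * T => X (Num.max z.1 0) z.2).
Proof.
move=> mX rcX.
pose k n (z : R * T) : R := Num.max z.1 0 * n.+1%:R.
have k0 n z : 0 <= k n z by rewrite mulr_ge0// le_max lexx orbT.
have mk n : measurable_fun setT (k n).
  apply: measurable_funM => //; apply: measurable_maxr => //.
pose u n z : R := (Num.truncn (k n z)).+1%:R / n.+1%:R.
apply: (@measurable_fun_cvg _ _ _ _ (fun n z => X (u n z) z.2)).
  move=> n; apply: (measurable_truncn_comp
    (f := fun m z => X (m.+1%:R / n.+1%:R) z.2)) => // m.
  exact: measurableT_comp.
move=> z _; set t := Num.max z.1 0.
have t0 : 0 <= t by rewrite le_max lexx orbT.
have /cvg_at_rightP rc := rcX z.2 t t0.
apply: (rc (fun n => u n z)); split.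
  by move=> n; rewrite ltr_pdivlMr//; exact: truncnS_gt.
apply: (@squeeze_cvgr _ _ _ _ (fun=> t) (fun n => t + n.+1%:R^-1)).
- apply: nearW => n; rewrite ler_pdivlMr// ltW ?truncnS_gt//=.
  rewrite ler_pdivrMr// mulrDl mulVf// -natr1 lerD2r.
  by rewrite truncn_le.
- exact: cvg_cst.
- rewrite -[X in _ --> X]addr0; apply: cvgD; first exact: cvg_cst.
  exact: cvg_harmonic.
Qed.

End right_continuous_process.

(** * Product formula for independent systems of events *)

Section independence.
Context d (T : measurableType d) (R : realType) (P : probability T R).
Local Open Scope ereal_scope.

(** Independence makes the joint law of H and K the product of their laws. *)
Lemma independent_expectationM (F G : set (set T)) (H K : T -> R) :
  independent_systems P F G ->
  measurable_fun setT H -> measurable_fun setT K ->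
  (forall w, (0 <= H w)%R) -> (forall w, (0 <= K w)%R) ->
  (forall A, measurable A -> F (H @^-1` A)) ->
  (forall A, measurable A -> G (K @^-1` A)) ->
  \int[P]_w (H w * K w)%:E = (\int[P]_w (H w)%:E) * (\int[P]_w (K w)%:E).
Proof.
move=> FG mH mK H0 K0 FH GK.
pose HX : {RV P >-> R} := HB.pack H (isMeasurableFun.Build _ _ _ _ _ mH).
pose KX : {RV P >-> R} := HB.pack K (isMeasurableFun.Build _ _ _ _ _ mK).
have mHK : measurable_fun setT (fun w => (H w, K w)) by exact: measurable_fun_pair.
pose HKX : {mfun T >-> (R * R)%type} :=
  HB.pack (fun w => (H w, K w)) (isMeasurableFun.Build _ _ _ _ _ mHK).
pose f (z : R * R) : \bar R := (`|z.1| * `|z.2|)%R%:E.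
have mf : measurable_fun setT f.
  apply/measurable_EFinP; apply: measurable_funM; exact: measurableT_comp.
have f0 z : 0 <= f z by rewrite lee_fin mulr_ge0.
have n0 (z : R) : (0 <= `|z|%:E :> \bar R) by rewrite lee_fin.
transitivity (\int[distribution P HKX]_z f z).
  rewrite ge0_integral_distribution//; apply: eq_integral => w _ /=.
  by rewrite /f /= !ger0_norm.
rewrite (_ : \int[distribution P HKX]_z f z =
    \int[distribution P HX \x distribution P KX]_z f z); last first.
  apply: eq_measure_integral => A mA _.
  apply/esym; apply: product_measure_unique => // B C mB mC.
  exact: FG (FH _ mB) (GK _ mC).
rewrite fubini_tonelli1//.
have intE (Z : {RV P >-> R}) : (forall w, (0 <= Z w)%R) ->
    \int[distribution P Z]_y `|y|%:E = \int[P]_w (Z w)%:E.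
  move=> Z0; rewrite ge0_integral_distribution//; last exact/measurable_EFinP.
  by apply: eq_integral => w _ /=; rewrite ger0_norm.
rewrite -(intE HX)// -(intE KX)// -ge0_integralZr//; last 2 first.
- exact/measurable_EFinP.
- exact: integral_ge0.
apply: eq_integral => x _; rewrite /fubini_F.
rewrite -ge0_integralZl//; last exact/measurable_EFinP.
Qed.

End independence.

(** * The Markov property of a killed subordinator *)

Section killed_subordinator_theory.
Context (R : realType) d (T : measurableType d) (P : probability T R).
Variables (X : R -> {RV P >-> R}) (kappa : R) (e : T -> \bar R) (phi : R -> R).
Hypothesis Xphi : killed_subordinator X kappa e phi.
Local Open Scope ereal_scope.

Let Xlevy : levy_process X.
Proof. exact: subordinator_levy (killed_subordinator_unkilled Xphi). Qed.

Lemma measurable_killing_time : measurable_fun setT e.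
Proof.
have := killed_time Xphi; rewrite /exponential_time; case: ifP => _.
  by move=> eoo; rewrite (funext eoo); exact: measurable_cst.
move=> [tau [etau _]]; rewrite (funext etau).
by apply/measurable_EFinP; exact: measurable_funPT.
Qed.

Definition alive (t : R) : set T := [set w | t%:E < e w].

Lemma measurable_alive t : measurable (alive t).
Proof.
rewrite -[alive t]setTI.
by apply: measurable_lte => //; exact: measurable_killing_time.
Qed.

(** The events up to time r are packaged as a type, so that being adapted is
    ordinary measurability and inherits its closure properties. *)
Definition past (r : R) := g_sigma_algebraType
  (\bigcup_(t in `[0%R, r]) sigma_fun (X t : T -> R)).

Lemma past_measurable_fun (r s : R) (H : T -> R) : (r <= s)%R ->
  measurable_fun [set: past r] H -> measurable_fun [set: past s] H.
Proof.
move=> rs mH _ A mA.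
have := mH measurableT A mA.
apply: sub_sigma_algebra2; apply: bigcup_subset => t/=; rewrite !in_itv/=.
by move=> /andP[-> /le_trans->].
Qed.

Lemma past_measurable_at (r t : R) : (0 <= t <= r)%R ->
  measurable_fun [set: past r] (X t).
Proof.
move=> tr _ A mA; apply: sub_sigma_algebra; exists t => //.
by exists A.
Qed.

Lemma measurable_fun_past (r : R) (H : T -> R) :
  measurable_fun [set: past r] H -> measurable_fun [set: T] H.
Proof.
move=> mH _ A mA; have := mH measurableT A mA.
apply: smallest_sub; first exact: sigma_algebra_measurable.
move=> B [t _ [C mC <-]]; exact: (@measurable_funPT _ _ _ _ (X t)).
Qed.

(** As the killing time is independent of the whole path, t may precede s. *)
Lemma integral_alive (s t : R) (H : T -> R) :
  measurable_fun [set: past s] H -> (forall w, (0 <= H w)%R) ->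
  \int[P]_(w in alive t) (H w)%:E = (\int[P]_w (H w)%:E) * P (alive t).
Proof.
move=> mH H0.
have mI : measurable_fun setT (\1_(alive t) : T -> R).
  exact/measurable_indic/measurable_alive.
rewrite -integral_indicMl.
under eq_integral do rewrite -EFinM mulrC.
rewrite (independent_expectationM (killed_independent Xphi)) //.
- by rewrite integral_indic ?setIT//; exact: measurable_alive.
- exact: measurable_fun_past mH.
- move=> A mA; have := mH measurableT A mA; rewrite setTI.
  apply: sub_sigma_algebra2; apply: bigcup_subset => q/=; rewrite !in_itv/=.
  by move=> /andP[->].
- move=> A mA; pose B : set (\bar R) := `]t%:E, +oo[%classic.
  have mB : measurable B by exact: emeasurable_itv.
  exists ((\1_B : \bar R -> R) @^-1` A).
    have mI1 := @measurable_indic _ (\bar R) R setT _ mB.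
    by rewrite -[X in measurable X]setTI; exact: mI1.
  rewrite setTI; apply/seteqP; split => w /=; rewrite !indicE;
    by rewrite (_ : (e w \in B) = (w \in alive t))//;
      apply/idP/idP; rewrite !inE /B /alive/= in_itv/= ?andbT// leey andbT.
Qed.

Lemma alive_probability t : (0 <= t)%R -> P (alive t) = (expR (- phi 0 * t))%:E.
Proof.
move=> t0; rewrite -(killed_laplace Xphi (lexx 0%R) t0).
under eq_integral do rewrite oppr0 mul0r expR0.
by rewrite integral_cst ?mul1e//; exact: measurable_alive.
Qed.

Lemma unkilled_laplace (u t : R) : (0 <= u)%R -> (0 <= t)%R ->
  (\int[P]_w (expR (- u * X t w))%:E) * P (alive t) = (expR (- phi u * t))%:E.
Proof.
move=> u0 t0; rewrite -(killed_laplace Xphi u0 t0) -(@integral_alive t)//.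
apply: (@measurableT_comp _ _ _ _ _ _ (fun x => expR (- u * x))%R) => /=.
  by apply: measurableT_comp => //; exact: measurable_expR.
by apply: past_measurable_at; rewrite t0 lexx.
Qed.

Lemma increment_laplace (u r s : R) (H : T -> R) : (0 <= r)%R -> (r <= s)%R ->
  measurable_fun [set: past r] H -> (forall w, (0 <= H w)%R) ->
  \int[P]_w (H w * expR (- u * X s w))%:E =
  (\int[P]_w (H w * expR (- u * X r w))%:E) *
  (\int[P]_w (expR (- u * X (s - r)%R w))%:E).
Proof.
move=> r0 rs mH H0; pose f (x : R) := expR (- u * x).
have mf : measurable_fun setT f.
  by apply: measurableT_comp => //; exact: measurable_expR.
have mfE : measurable_fun setT (EFin \o f) by exact/measurable_EFinP.
pose D := (X s \- X r : T -> R)%R.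
have mD : measurable_fun setT D by exact: measurable_funB.
have -> : \int[P]_w (expR (- u * X (s - r)%R w))%:E = \int[P]_w (f (D w))%:E.
  transitivity (\int[distribution P (X (s - r)%R)]_y (EFin \o f) y).
    by rewrite ge0_integral_distribution// => y; rewrite lee_fin expR_ge0.
  rewrite -(@ge0_integral_pushforward _ _ _ _ _ _ mD P setT (EFin \o f))//;
    last by move=> y _; rewrite lee_fin expR_ge0.
  apply: eq_measure_integral => A mA _; apply/esym.
  exact: (levy_stationary_increments Xlevy r0 rs).
under eq_integral => w _.
  rewrite (_ : - u * X s w = - u * X r w + - u * D w)%R; last first.
    by rewrite /D/=; ring.
  rewrite expRD mulrA; over.
have mHr : measurable_fun [set: past r] (fun w => H w * f (X r w))%R.
  apply: measurable_funM => //; apply: measurableT_comp => //.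
  by apply: past_measurable_at; rewrite r0 lexx.
apply: (independent_expectationM (levy_independent_increments Xlevy r0 rs)).
- exact: measurable_fun_past mHr.
- exact: (measurableT_comp mf mD).
- by move=> w; rewrite mulr_ge0 ?expR_ge0.
- by move=> w; exact: expR_ge0.
- by move=> A mA; have := mHr measurableT A mA; rewrite setTI.
- move=> A mA; exists (f @^-1` A).
    by rewrite -[X in measurable X]setTI; exact: mf.
  by rewrite setTI.
Qed.

(** The increment over [r, s] is independent of the past and stationary, and
    survival contributes expR (- phi 0 * (s - r)), which turns the exponent of
    the unkilled process into phi. *)
Lemma markov_step (u r s : R) (H : T -> R) : (0 <= u)%R -> (0 <= r)%R -> (r <= s)%R ->
  measurable_fun [set: past r] H -> (forall w, (0 <= H w)%R) ->
  \int[P]_(w in alive s) (H w * expR (- u * X s w))%:E =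
  (\int[P]_(w in alive r) (H w * expR (- u * X r w))%:E) *
  (expR (- phi u * (s - r)))%:E.
Proof.
move=> u0 r0 rs mH H0; have s0 := le_trans r0 rs.
have mHr t q : (r <= q)%R -> (0 <= t <= q)%R ->
    measurable_fun [set: past q] (fun w => H w * expR (- u * X t w))%R.
  move=> rq tr; apply: measurable_funM; first exact: past_measurable_fun rq mH.
  apply: (@measurableT_comp _ _ _ _ _ _ (fun x => expR (- u * x))%R) => /=.
    by apply: measurableT_comp => //; exact: measurable_expR.
  exact: past_measurable_at.
rewrite (integral_alive _ (mHr s s _ _)) ?s0 ?lexx//; last first.
  by move=> w; rewrite mulr_ge0 ?expR_ge0.
rewrite (integral_alive _ (mHr r r _ _)) ?r0 ?lexx//; last first.
  by move=> w; rewrite mulr_ge0 ?expR_ge0.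
rewrite (increment_laplace _ r0)// -!muleA; congr (_ * _).
rewrite -(@unkilled_laplace u (s - r)) ?subr_ge0// muleCA; congr (_ * _).
rewrite !alive_probability ?subr_ge0// -EFinM -expRD; congr (expR _)%:E.
by ring.
Qed.

End killed_subordinator_theory.

(** * Monotonicity and positivity of the Laplace exponent *)

Section laplace_exponent.
Context (R : realType) d (T : measurableType d) (P : probability T R).
Variables (X : R -> {RV P >-> R}) (kappa : R) (e : T -> \bar R) (phi : R -> R).
Hypothesis Xphi : killed_subordinator X kappa e phi.
Local Open Scope ereal_scope.

Let f (u : R) (w : T) : \bar R := (expR (- u * X 1%R w))%:E.

Let f_ge0 u w : 0 <= f u w. Proof. by rewrite lee_fin expR_ge0. Qed.

Let mf u : measurable_fun setT (f u).
Proof.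
apply/measurable_EFinP; apply: measurableT_comp; first exact: measurable_expR.
by apply: measurable_funM => //; exact: measurable_funPT.
Qed.

Let laplace1 u : (0 <= u)%R ->
  \int[P]_(w in alive e 1) f u w = (expR (- phi u))%:E.
Proof. by move=> u0; rewrite (killed_laplace Xphi u0 ler01) mulr1. Qed.

Let m1 : measurable (alive e 1). Proof. exact: (measurable_alive Xphi). Qed.

Let X1_ge0 w : (0 <= X 1 w)%R.
Proof. exact: (subordinator_ge0 (killed_subordinator_unkilled Xphi)). Qed.

Lemma laplace_exponent_le u v : (0 <= u)%R -> (u <= v)%R -> (phi u <= phi v)%R.
Proof.
move=> u0 uv; have v0 := le_trans u0 uv.
rewrite -lerN2 -ler_expR -lee_fin -!laplace1//.
apply: ge0_le_integral => //; do ?exact: measurable_funTS.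
move=> w _; rewrite lee_fin ler_expR !mulNr lerN2.
by rewrite ler_wpM2r.
Qed.

Lemma laplace_exponent_ge0 u : (0 <= u)%R -> (0 <= phi u)%R.
Proof.
move=> u0; rewrite -oppr_le0 -expR_le1 -lee_fin -laplace1//.
apply: (@le_trans _ _ (\int[P]_(w in alive e 1) 1)).
  apply: ge0_le_integral => //; first exact: measurable_funTS.
  move=> w _; rewrite lee_fin expR_le1 mulNr oppr_le0.
  by rewrite mulr_ge0.
by rewrite integral_cst// mul1e; exact: probability_le1.
Qed.

(** If phi s = 0, then exp (- s * X_1) 1_{1 < e} has integral 1; by the inequality
    of Bernoulli so has each of its powers, hence phi (n * s) = 0 for all n,
    and monotonicity makes phi vanish. *)
Lemma laplace_exponent_gt0 : (exists2 u, (0 <= u)%R & phi u != 0%R) ->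
  forall s, (0 < s)%R -> (0 < phi s)%R.
Proof.
move=> [u u0 /eqP phiu] s s0; have s0' := ltW s0.
rewrite lt_neqAle laplace_exponent_ge0// andbT; apply/eqP => phis; apply: phiu.
pose m := Num.bound (u / s); pose n := m.+1.
have uns : (u <= n%:R * s)%R.
  rewrite -ler_pdivrMr// ltW// (lt_le_trans (archi_boundP _)) ?divr_ge0//.
  by rewrite ler_nat.
have ns0 : (0 <= n%:R * s)%R by exact: le_trans uns.
apply/eqP; rewrite eq_le laplace_exponent_ge0// andbT.
apply: (le_trans (laplace_exponent_le u0 uns)).
suff : (1 <= expR (- phi (n%:R * s)))%R.
  by apply: contraTT; rewrite -!ltNge expR_lt1 oppr_lt0.
have : n%:R%:E * (\int[P]_(w in alive e 1) f s w) <=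
    \int[P]_(w in alive e 1) f (n%:R * s) w + m%:R%:E * P (alive e 1).
  have mfA v : measurable_fun (alive e 1) (f v) by exact: measurable_funTS.
  rewrite -(integral_cst P m1) -ge0_integralD//; last first.
    by move=> w _; rewrite lee_fin.
  rewrite -ge0_integralZl//.
  apply: ge0_le_integral => //.
  - by move=> w _; rewrite mule_ge0.
  - by apply: measurable_funeM; exact: measurable_funTS.
  - by apply: emeasurable_funD => //; exact: measurable_funTS.
  move=> w _; rewrite /= -EFinM -EFinD lee_fin.
  pose x := expR (- s * X 1 w).
  have x1 : (-1 <= x - 1)%R by rewrite lerBrDr addNr expR_ge0.
  have := bernoulli_ineq n x1; rewrite [(1 + (x - 1))%R]addrC subrK.
  rewrite /x -expRM_natl -/x (_ : n%:R * (- s * X 1 w) = - (n%:R * s) * X 1 w)%R.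
    by rewrite /n -natr1; lra.
  by ring.
rewrite !laplace1// -phis oppr0 expR0 mule1 => h.
have : n%:R%:E <= (expR (- phi (n%:R * s)))%:E + m%:R%:E.
  by apply: le_trans h _; rewrite leeD2l// -[leRHS]mule1 lee_wpmul2l// probability_le1.
by rewrite -EFinD lee_fin /n -natr1 addrC lerD2r.
Qed.

End laplace_exponent.

(** * Integer moments of the exponential functional *)

Lemma integral_expR_tail (R : realType) (c r : R) : 0 < c ->
  (\int[@lebesgue_measure R]_(s in `[r, +oo[) (expR (- c * (s - r)))%:E =
   (c^-1)%:E)%E.
Proof.
move=> c0; pose F (s : R) := - (c^-1 * expR (- c * (s - r))).
have dF (s : R) : is_derive s 1 F (expR (- c * (s - r))).
  rewrite /F; apply: is_derive_eq.
  by rewrite /GRing.scale/= subr0 mulr1; field; rewrite gt_eqF.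
have cf : continuous (fun s : R => expR (- c * (s - r))).
  move=> s; apply: continuous_comp; last exact: continuous_expR.
  by apply: cvgMr; apply: cvgB; [exact: cvg_id|exact: cvg_cst].
rewrite (@ge0_continuous_FTC2y _ _ F _ 0)//.
- by rewrite /F subrr mulr0 expR0 mulr1 EFinN oppeK add0e.
- by apply: continuous_subspaceT.
- rewrite (_ : F = fun s => - (c^-1 * expR (c * r)) * expR (- (c * s))).
    rewrite -[X in _ --> X](mulr0 (- (c^-1 * expR (c * r)))); apply: cvgMr.
    apply: (@cvg_comp _ _ _ ( *%R c) (fun z => expR (- z)) _ (pinfty_nbhs R)).
      exact: gt0_cvgMry.
    exact: cvgr_expR.
  apply/funext => s; rewrite /F.
  rewrite (_ : - c * (s - r) = c * r + - (c * s)); last by ring.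
  by rewrite expRD; ring.
- apply: cvg_at_right_filter; apply: differentiable_continuous.
  by apply/derivable1_diffP; have [] := dF r.
- by move=> s _; rewrite derive1E; exact: derive_val.
Qed.

Section moments.
Context (R : realType) d (T : measurableType d) (P : probability T R).
Variables (X : R -> {RV P >-> R}) (kappa : R) (e : T -> \bar R) (phi : R -> R).
Hypothesis Xphi : killed_subordinator X kappa e phi.
Local Open Scope ereal_scope.
Local Notation mu := (@lebesgue_measure R).
Local Notation alive := (alive e).

(** Negative times are sent to 0, so that the paths are right-continuous on the
    whole line and the discount factor is jointly measurable. *)
Definition discount (z : R * T) : R :=
  (\1_(alive z.1) z.2 * expR (- X (Num.max z.1 0) z.2))%R.

Lemma discount_ge0 z : (0 <= discount z)%R.
Proof. by rewrite mulr_ge0// expR_ge0. Qed.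

Lemma measurable_discount : measurable_fun setT discount.
Proof.
have Xlevy := subordinator_levy (killed_subordinator_unkilled Xphi).
apply: measurable_funM.
  pose S : set (R * T) := [set z | z.1%:E < e z.2].
  have mS : measurable S.
    rewrite -[S]setTI; apply: measurable_lte => //.
      by apply/measurable_EFinP; exact: measurable_fst.
    exact: (measurableT_comp (measurable_killing_time Xphi) measurable_snd).
  have mI := @measurable_indic _ _ R setT _ mS.
  apply: eq_measurable_fun mI => z _; rewrite !indicE.
  by congr (nat_of_bool _)%:R; apply/idP/idP; rewrite !inE.
apply: measurableT_comp; first exact: measurable_expR.
apply: measurableT_comp => //.
apply: (measurable_right_continuous_process (X := fun t => X t)).
  by move=> t; exact: measurable_funPT.
exact: levy_right_continuous Xlevy.
Qed.

Let mdiscountE : measurable_fun setT (EFin \o discount).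
Proof. by apply/measurable_EFinP; exact: measurable_discount. Qed.

(** For n = 1 and q = 0 this is the exponential functional; in general it is the
    n-th power of the integral from time q on, divided by n!. *)
Definition tail_functional n q w :=
  iterated_tail (fun s => (discount (s, w))%:E) n q.

Lemma tail_functional_ge0 n q w : 0 <= tail_functional n q w.
Proof. by apply: iterated_tail_ge0 => s; rewrite lee_fin discount_ge0. Qed.

Lemma measurable_tail_functional n :
  measurable_fun setT (fun z : R * T => tail_functional n z.1 z.2).
Proof.
apply: (measurable_iterated_tail n mdiscountE) => z.
by rewrite lee_fin discount_ge0.
Qed.

Lemma discountE s w : (0 <= s)%R ->
  discount (s, w) = (\1_(alive s) w * expR (- X s w))%R.
Proof. by move=> s0; rewrite /discount max_l. Qed.

Lemma exp_functionalE w : exp_functional (fun t => X t) e w = tail_functional 1 0 w.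
Proof.
rewrite /exp_functional integral_mkcond /tail_functional/=.
rewrite [RHS]integral_mkcond; apply: eq_integral => s _.
rewrite !patchE mule1.
have [s0|s0] := leP 0%R s; last first.
  by rewrite !memNset//= ?in_itv/= ?andbT -?ltNge// => -[]; rewrite leNgt s0.
have s1 : s \in (`[0%R, +oo[%classic : set R) by rewrite inE/= in_itv/= s0.
rewrite s1.
rewrite discountE// indicE.
have [se|se] := pselect (s%:E < e w); last by rewrite !memNset//= ?mul0r// => -[].
by rewrite !mem_set// mul1r.
Qed.

Lemma exp_functional_pow w n :
  exp_functional (fun t => X t) e w ^+ n = n`!%:R%:E * tail_functional n 0 w.
Proof.
rewrite exp_functionalE iterated_tail_pow// => [|s]; last first.
  by rewrite lee_fin discount_ge0.
exact: (measurable_fun_pair1 w mdiscountE).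
Qed.

Lemma measurable_exp_functional :
  measurable_fun setT (exp_functional (fun t => X t) e).
Proof.
rewrite (_ : exp_functional _ _ = tail_functional 1 0).
  have := measurable_fun_pair2 (0%R : R) (measurable_tail_functional 1).
  by [].
by apply/funext => w; exact: exp_functionalE.
Qed.

Hypothesis phi_gt0 : forall s, (0 < s -> 0 < phi s)%R.

(** Induction on n for all adapted H at once: the first of the n + 1 ordered
    times, s, moves its discount factor expR (- X s) into H, which is then
    adapted at s.  The Markov property makes the integral over s exponential. *)
Lemma tail_functional_moment n (r : R) (H : T -> R) : (0 <= r)%R ->
  measurable_fun [set: past X r] H -> (forall w, (0 <= H w)%R) ->
  \int[P]_(w in alive r) ((H w)%:E * tail_functional n r w) =
  (\prod_(k < n) (phi k.+1%:R)^-1)%:E *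
  \int[P]_(w in alive r) (H w * expR (- n%:R * X r w))%:E.
Proof.
elim: n r H => [|n ih] r H r0 mH H0.
  rewrite big_ord0 mul1e; apply: eq_integral => w _.
  by rewrite oppr0 mul0r expR0 mulr1 mule1.
set c := (\prod_(k < n) _)%R in ih.
have mHT := measurable_fun_past mH.
have malive t := measurable_alive Xphi t.
pose D (w : T) (s : R) := (discount (s, w))%:E * tail_functional n s w.
have mD : measurable_fun setT (fun z : T * R => D z.1 z.2).
  pose D' (z : R * T) := (discount z)%:E * tail_functional n z.1 z.2.
  have mD' : measurable_fun setT D'.
    apply: emeasurable_funM; [exact: mdiscountE|].
    exact: measurable_tail_functional.
  exact: (measurableT_comp mD' (@measurable_swap _ _ T R)).
have D0 w s : 0 <= D w s by rewrite mule_ge0 ?lee_fin ?discount_ge0 ?tail_functional_ge0.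
pose F (z : T * R) := ((\1_(alive r) z.1 * \1_(`[r, +oo[%classic : set R) z.2)%R)%:E *
  ((H z.1)%:E * D z.1 z.2).
have mF : measurable_fun setT F.
  apply: emeasurable_funM.
    apply/measurable_EFinP; apply: measurable_funM.
      have mI := @measurable_indic _ T R setT _ (malive r).
      exact: (measurableT_comp mI measurable_fst).
    have mI := @measurable_indic _ _ R setT _ (measurable_itv `[r, +oo[).
    exact: (measurableT_comp mI measurable_snd).
  apply: emeasurable_funM => //; apply/measurable_EFinP.
  exact: measurableT_comp.
have F0 z : 0 <= F z.
  by rewrite mule_ge0 ?lee_fin ?mulr_ge0// mule_ge0 ?lee_fin.
transitivity (\int[P]_w \int[mu]_s F (w, s)).
  rewrite -integral_indicMl; apply: eq_integral => w _ /=.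
  transitivity (\int[mu]_s ((\1_(`[r, +oo[%classic : set R) s)%:E *
      ((\1_(alive r) w * H w)%:E * D w s))).
    rewrite integral_indicMl ge0_integralZl//.
    - by rewrite EFinM muleA.
    - apply: measurable_funTS.
      exact: (measurable_fun_pair2 w mD).
    - by rewrite lee_fin mulr_ge0.
  apply: eq_integral => s _; rewrite /F/= !EFinM -!muleA.
  exact: muleCA.
rewrite (@fubini_tonelli _ _ _ _ R P mu F mF F0).
pose A := \int[P]_(w in alive r) (H w * expR (- n.+1%:R * X r w))%:E.
have A0 : 0 <= A by apply: integral_ge0 => w _; rewrite lee_fin mulr_ge0 ?expR_ge0.
transitivity (\int[mu]_(s in `[r, +oo[)
   (c%:E * A * (expR (- phi n.+1%:R * (s - r)))%:E)).
  rewrite -[RHS]integral_indicMl; apply: eq_integral => s _.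
  have [rs|rs] := boolP (s \in (`[r, +oo[%classic : set R)); last first.
    have s1 : \1_(`[r, +oo[%classic : set R) s = 0%R :> R.
      by rewrite indicE (negbTE rs).
    by rewrite s1 mul0e; apply: integral0_eq => w _; rewrite /F/= s1 mulr0 mul0e.
  have {}rs : (r <= s)%R by move: rs; rewrite inE/= in_itv/= andbT.
  have s0 := le_trans r0 rs.
  have s1 : \1_(`[r, +oo[%classic : set R) s = 1%R :> R.
    by rewrite indicE mem_set//= in_itv/= rs.
  have mHs : measurable_fun [set: past X s] (fun w => H w * expR (- X s w))%R.
    apply: measurable_funM; first exact: past_measurable_fun rs mH.
    apply: measurableT_comp; first exact: measurable_expR.
    apply: measurableT_comp => //.
    by apply: past_measurable_at; rewrite s0 lexx.
  have ih_s := ih s _ s0 mHs (fun w => mulr_ge0 (H0 w) (expR_ge0 _)).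
  rewrite s1 mul1e -muleA.
  transitivity (c%:E *
      \int[P]_(w in alive s) (H w * expR (- n.+1%:R * X s w))%:E); last first.
    by rewrite (markov_step Xphi (ler0n _ _) r0 rs mH H0).
  under [in RHS]eq_integral => w _.
    rewrite (_ : (- n.+1%:R * X s w = - X s w + - n%:R * X s w)%R); last first.
      by rewrite -natr1; ring.
    rewrite expRD mulrA; over.
  rewrite -ih_s -[RHS]integral_indicMl; apply: eq_integral => w _.
  have aE : \1_(alive s) w = (\1_(alive r) w * \1_(alive s) w)%R :> R.
    rewrite !indicE; have [|_] := boolP (w \in alive s); last by rewrite mulr0.
    rewrite inE => sw; rewrite mem_set ?mulr1//=.
    by apply: le_lt_trans sw; rewrite lee_fin.
  rewrite [in RHS]aE /F/= s1 mulr1 /D discountE// !EFinM -!muleA.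
  by congr (_ * _); exact: muleCA.
have c0 : (0 <= c)%R.
  by apply: prodr_ge0 => k _; rewrite invr_ge0 ltW// phi_gt0.
have mexp : measurable_fun (`[r, +oo[%classic : set R)
    (fun s : R => (expR (- phi n.+1%:R * (s - r)))%:E).
  apply/measurable_EFinP; apply: measurableT_comp; first exact: measurable_expR.
  by apply: measurable_funM => //; exact: measurable_funB.
rewrite ge0_integralZl// ?mule_ge0 ?lee_fin//.
rewrite integral_expR_tail ?phi_gt0// big_ord_recr/= EFinM -/c.
by rewrite -!muleA; congr (_ * _); rewrite muleC.
Qed.

Lemma exp_functional_moment n :
  \int[P]_w (exp_functional (fun t => X t) e w ^+ n) =
  (\prod_(k < n) (k.+1%:R / phi k.+1%:R))%:E.
Proof.
under eq_integral do rewrite exp_functional_pow.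
have m0 : measurable_fun setT (tail_functional n 0).
  by have := measurable_fun_pair2 (0%R : R) (measurable_tail_functional n).
rewrite ge0_integralZl//; last by move=> w _; exact: tail_functional_ge0.
case: n m0 => [|n] m0.
  rewrite big_ord0 fact0 mul1e /tail_functional/= integral_cst// mul1e.
  exact: probability_setT.
have -> : \int[P]_w tail_functional n.+1 0 w =
    \int[P]_(w in alive 0) (1%:E * tail_functional n.+1 0 w).
  rewrite -[RHS]integral_indicMl; apply: eq_integral => w _.
  rewrite indicE mul1e; have [_|w0] := boolP (w \in alive 0); first by rewrite mul1e.
  rewrite mul0e; apply: integral0_eq => s; rewrite /= in_itv/= andbT => s0.
  rewrite discountE// indicE memNset ?mul0r ?mul0e// => sw.
  by move/negP: w0; apply; rewrite inE; apply: le_lt_trans sw; rewrite lee_fin.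
rewrite (tail_functional_moment n.+1 (lexx 0%R)
  (measurable_cst (1%R : R)) (fun=> ler01)).
have Xlevy := subordinator_levy (killed_subordinator_unkilled Xphi).
under eq_integral do rewrite (levy_start Xlevy) mulr0 expR0 mulr1 /=.
rewrite integral_cst ?mul1e; last exact: (measurable_alive Xphi).
have alive0 : P (alive 0%R) = 1.
  by rewrite (alive_probability Xphi (lexx 0%R)) mulr0 expR0.
rewrite [X in _ * (_ * X)](_ : _ = 1); last exact: alive0.
rewrite mule1 -EFinM; congr _%:E.
elim: {m0} n.+1 => [|m ih]; first by rewrite !big_ord0 fact0 mulr1.
rewrite !big_ord_recr/= -ih factS natrM; ring.
Qed.

End moments.

(** * An integral of a real power *)

Lemma integral_powR (R : realType) (q y : R) : 0 <= q -> 0 <= y ->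
  (\int[@lebesgue_measure R]_(z in `[0%R, y[) (z `^ q)%:E =
   (y `^ (q + 1) / (q + 1))%:E)%E.
Proof.
move=> q0; rewrite le_eqVlt => /predU1P[<-|y0].
  rewrite set_itvco0 integral_set0 powR0 ?mul0r// gt_eqF//.
  by rewrite ltr_wpDl.
have q1 : 0 < q + 1 by rewrite ltr_wpDl.
pose F (z : R) := (q + 1)^-1 * z `^ (q + 1).
have dF (z : R) : 0 < z -> is_derive z 1 F (z `^ q).
  move=> z0; have := is_derive1_powR (q + 1) z0.
  rewrite addrK => ?; rewrite /F; apply: is_derive_eq.
  by rewrite /GRing.scale/= mulrA mulVf ?mul1r// gt_eqF.
have cF (p z : R) : 0 < z -> {for z, continuous (@powR R ^~ p)}.
  move=> z0; apply: differentiable_continuous; apply/derivable1_diffP.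
  by have [] := is_derive1_powR p z0.
have c0 (p : R) : 0 <= p -> (x `^ p) @[x --> 0^'+] --> (0 `^ p : R).
  rewrite le_eqVlt => /predU1P[<-|p0].
    rewrite (_ : (fun x => x `^ 0) = cst 1); last by apply/funext => x; rewrite powRr0.
    by rewrite powRr0; exact: cvg_cst.
  by rewrite powR0 ?gt_eqF//; exact: powR_cvg0.
have mpow p : measurable_fun [set: R] (fun z : R => (z `^ p)%:E).
  by apply/measurable_EFinP; exact: measurable_powR.
rewrite integral_itv_bndo_bndc; last exact: measurable_funTS.
rewrite (@continuous_FTC2 _ (fun z => z `^ q) F)//.
- by rewrite /F powR0 ?gt_eqF// mulr0 sube0 mulrC.
- apply/continuous_within_itvP => //; split.
  + by move=> z; rewrite in_itv/= => /andP[z0 _]; exact: cF.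
  + exact: c0.
  + by apply: cvg_at_left_filter; exact: cF.
- split.
  + by move=> z; rewrite in_itv/= => /andP[z0 _]; have [] := dF z z0.
  + by apply: cvgMr; apply: c0; exact: ltW.
  + by apply: cvgMr; apply: cvg_at_left_filter; exact: cF.
- by move=> z; rewrite in_itv/= => /andP[z0 _]; rewrite derive1E; have [] := dF z z0.
Qed.

(** * Determinacy of weighted laws *)

Section weighted_moment_problem.
Local Open Scope ereal_scope.
Context (R : realType) d1 d2 (T1 : measurableType d1) (T2 : measurableType d2).
Variables (mu1 : {measure set T1 -> \bar R}) (mu2 : {measure set T2 -> \bar R}).
Variables (w1 Y1 : T1 -> R) (w2 Y2 : T2 -> R).
Hypotheses (mw1 : measurable_fun setT w1) (mw2 : measurable_fun setT w2).
Hypotheses (mY1 : measurable_fun setT Y1) (mY2 : measurable_fun setT Y2).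
Hypotheses (w1_ge0 : forall x, (0 <= w1 x)%R) (w2_ge0 : forall x, (0 <= w2 x)%R).
Hypotheses (Y1_ge0 : forall x, (0 <= Y1 x)%R) (Y2_ge0 : forall x, (0 <= Y2 x)%R).
Variables (C M : R).
Hypothesis M_gt0 : (0 < M)%R.
Hypothesis moments_eq : forall n,
  \int[mu1]_x ((Y1 x ^+ n)%:E * (w1 x)%:E) =
  \int[mu2]_x ((Y2 x ^+ n)%:E * (w2 x)%:E).
Hypothesis moments_le : forall n,
  \int[mu1]_x ((Y1 x ^+ n)%:E * (w1 x)%:E) <= (C * M ^+ n * n`!%:R)%:E.

Let D := (`[0%R, +oo[%classic : set (measurableTypeR R)).

Let law_moment d (T : measurableType d) (mu : {measure set T -> \bar R})
  (w Y : T -> R) (mw : measurable_fun setT w) (w0 : forall x, (0 <= w x)%R)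
  (mY : measurable_fun setT Y) n : (forall x, (0 <= Y x)%R) ->
  \int[weighted_law mu mw w0 mY]_(x in D) (x ^+ n)%:E =
  \int[mu]_x ((Y x ^+ n)%:E * (w x)%:E).
Proof.
move=> Y0; rewrite -[LHS]integral_indicMl.
have mf : measurable_fun setT (fun x : measurableTypeR R => \1_D x * `|x| ^+ n)%R.
  apply: measurable_funM; last exact: measurable_funX.
  by apply: measurable_indic; exact: measurable_itv.
transitivity (\int[weighted_law mu mw w0 mY]_x (\1_D x * `|x| ^+ n)%R%:E).
  apply: eq_integral => x _; rewrite -EFinM !indicE.
  have [|_] := boolP (x \in D); last by rewrite !mul0r.
  by rewrite inE/D/= in_itv/= andbT => x0; rewrite ger0_norm.
rewrite (ge0_integral_weighted_law _ _ _ _ mf); last first.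
  by move=> x; rewrite mulr_ge0// exprn_ge0.
apply: eq_integral => x _; rewrite indicE mem_set ?mul1r ?ger0_norm//.
by rewrite /D/= in_itv/= andbT.
Qed.

(** The moment problem on the half-line, transported to the weighted laws of Y1
    and Y2: the two sides may live on different spaces. *)
Lemma eq_weighted_integral_of_moments (f : R -> R) :
  measurable_fun setT f -> (forall x, (0 <= f x)%R) ->
  \int[mu1]_x ((f (Y1 x))%:E * (w1 x)%:E) =
  \int[mu2]_x ((f (Y2 x))%:E * (w2 x)%:E).
Proof.
move=> mf f0.
rewrite -(ge0_integral_weighted_law mu1 mw1 w1_ge0 mY1)//.
rewrite -(ge0_integral_weighted_law mu2 mw2 w2_ge0 mY2)//.
apply: eq_measure_integral => A mA _.
have mD : measurable D by exact: measurable_itv.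
have lawD d (T : measurableType d) (mu : {measure set T -> \bar R})
    (w Y : T -> R) (mw : measurable_fun setT w) (w0 : forall x, (0 <= w x)%R)
    (mY : measurable_fun setT Y) : (forall x, (0 <= Y x)%R) ->
    weighted_law mu mw w0 mY A = weighted_law mu mw w0 mY (A `&` D).
  move=> Y0; rewrite /weighted_law preimage_setI [X in _ `&` X](_ : _ = setT) ?setIT//.
  by apply/seteqP; split => // x _; rewrite /D/= in_itv/= andbT.
rewrite /= (lawD _ _ mu1)// (lawD _ _ mu2)//.
apply: (@eq_measure_of_moments _ (weighted_law mu1 mw1 w1_ge0 mY1)
  (weighted_law mu2 mw2 w2_ge0 mY2) C M M_gt0).
- by move=> n; rewrite !law_moment.
- by move=> n; rewrite law_moment.
- exact: measurableI.
- by move=> x [].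
Qed.

End weighted_moment_problem.

(** * Real moments of the exponential functional *)

Section power_moments.
Context (R : realType) d (T : measurableType d) (P : probability T R).
Variables (X : R -> {RV P >-> R}) (kappa : R) (e : T -> \bar R) (phi : R -> R).
Hypothesis Xphi : killed_subordinator X kappa e phi.
Hypothesis phi_gt0 : forall s, (0 < s -> 0 < phi s)%R.
Local Open Scope ereal_scope.
Local Notation mu := (@lebesgue_measure R).
Local Notation I := (exp_functional (fun t => X t) e).

Lemma exp_functional_ge0 w : 0 <= I w.
Proof. by apply: integral_ge0 => s _; rewrite lee_fin expR_ge0. Qed.

Let mI : measurable_fun setT I. Proof. exact: (measurable_exp_functional Xphi). Qed.

Lemma exp_functional_ae_fin : {ae P, forall w, I w \is a fin_num}.
Proof.
suff iI : P.-integrable setT I.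
  by apply: filterS (integrable_ae measurableT iI) => w; exact.
apply/integrableP; split => //.
under eq_integral do rewrite gee0_abs ?exp_functional_ge0//.
have : \int[P]_w I w = _ := exp_functional_moment Xphi phi_gt0 1%N.
by move=> ->; rewrite ltry.
Qed.

(** The moment problem concerns real variables; the exponential functional is
    almost surely finite, so taking its finite part changes no integral. *)
Definition real_exp_functional w : R := fine (I w).
Local Notation Y := real_exp_functional.

Lemma measurable_real_exp_functional : measurable_fun setT Y.
Proof. exact: (measurableT_comp (fine_measurable measurableT) mI). Qed.

Lemma real_exp_functional_ge0 w : (0 <= Y w)%R.
Proof. by apply: fine_ge0; exact: exp_functional_ge0. Qed.

Lemma integral_real_exp_functional (f : \bar R -> \bar R) :
  measurable_fun setT f -> (forall x, 0 <= f x) ->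
  \int[P]_w f (Y w)%:E = \int[P]_w f (I w).
Proof.
move=> mf f0; apply: ge0_ae_eq_integral => //.
- apply: measurableT_comp => //; apply/measurable_EFinP.
  exact: measurable_real_exp_functional.
- exact: measurableT_comp.
- apply: filterS exp_functional_ae_fin => w Iw _.
  by rewrite fineK.
Qed.

Lemma real_exp_functional_moment n :
  \int[P]_w (Y w ^+ n)%:E = (\prod_(k < n) (k.+1%:R / phi k.+1%:R))%:E.
Proof.
rewrite -(exp_functional_moment Xphi phi_gt0).
transitivity (\int[P]_w `|(Y w)%:E| ^+ n).
  apply: eq_integral => w _; rewrite gee0_abs ?EFin_expe//.
  by rewrite lee_fin real_exp_functional_ge0.
rewrite (integral_real_exp_functional (f := fun x => `|x| ^+ n)).
- by apply: eq_integral => w _; rewrite gee0_abs// exp_functional_ge0.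
- elim: n => [|n ih]; first exact: measurable_cst.
  under eq_fun do rewrite expeS.
  exact: emeasurable_funM.
- by move=> x; rewrite expe_ge0.
Qed.

Lemma moment_product_le n :
  (\prod_(k < n) (k.+1%:R / phi k.+1%:R) <= (phi 1)^-1 ^+ n * n`!%:R)%R.
Proof.
elim: n => [|n ih]; first by rewrite big_ord0 expr0 fact0 mulr1.
have phi1 : (0 < phi 1)%R by exact: phi_gt0.
rewrite big_ord_recr/=.
apply: (@le_trans _ _ ((phi 1)^-1 ^+ n * n`!%:R * (n.+1%:R / phi n.+1%:R)))%R.
  by rewrite ler_wpM2r// divr_ge0// ltW// phi_gt0.
rewrite exprSr factS natrM.
have -> : ((phi 1)^-1 ^+ n * (phi 1)^-1 * (n.+1%:R * n`!%:R) =
    (phi 1)^-1 ^+ n * n`!%:R * (n.+1%:R / phi 1))%R by ring.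
apply: ler_wpM2l; first by rewrite mulr_ge0// exprn_ge0// invr_ge0 ltW.
rewrite ler_wpM2l// lef_pV2 ?posrE ?phi_gt0//.
by apply: (laplace_exponent_le Xphi) => //; rewrite ler1n.
Qed.

Let mY : measurable_fun setT Y. Proof. exact: measurable_real_exp_functional. Qed.
Let Y0 w : (0 <= Y w)%R. Proof. exact: real_exp_functional_ge0. Qed.

Let mpow q d' (U : measurableType d') (f : U -> R) :
  measurable_fun setT f -> measurable_fun setT (fun x => (f x `^ q)%R).
Proof.
by move=> mf; exact: (measurableT_comp (measurable_powR q) mf).
Qed.

(** The first coordinate z, under Lebesgue measure times P restricted to this
    set, has the law P(I > z) dz on the half-line. *)
Definition below_graph : set (R * T) := [set z | (0 <= z.1)%R && (z.1 < Y z.2)%R].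

Lemma measurable_below_graph : measurable below_graph.
Proof.
rewrite (_ : below_graph = [set z | (0 <= z.1)%R] `\` [set z | (Y z.2 <= z.1)%R]).
  apply: measurableD; apply: measurable_ler_set => //.
  exact: (measurableT_comp mY measurable_snd).
apply/seteqP; split => z /=; rewrite /below_graph/=.
  by move=> /andP[-> zY]; split => //; apply/negP; rewrite -ltNge.
by move=> [-> /negP]; rewrite -ltNge.
Qed.

Lemma integral_below_graph q : (0 <= q)%R ->
  \int[mu \x P]_z ((Num.max z.1 0 `^ q)%R%:E * (\1_below_graph z)%:E) =
  ((q + 1)^-1)%:E * \int[P]_w (Y w `^ (q + 1))%R%:E.
Proof.
move=> q0; have mS := measurable_below_graph.
rewrite fubini_tonelli2; last 2 first.
- apply: emeasurable_funM; apply/measurable_EFinP; last exact: measurable_indic.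
  by apply: mpow => //; apply: measurable_maxr => //; exact: measurable_fst.
- by move=> z; rewrite mule_ge0// lee_fin powR_ge0.
rewrite -ge0_integralZl//; last 3 first.
- by apply/measurable_EFinP; exact: mpow.
- by move=> w _; rewrite lee_fin powR_ge0.
- by rewrite lee_fin invr_ge0 addr_ge0.
apply: eq_integral => w _; rewrite /fubini_G -EFinM mulrC -integral_powR//.
rewrite -[RHS]integral_indicMl; apply: eq_integral => z _.
rewrite muleC/= !indicE.
rewrite (_ : ((z, w) \in below_graph) = (z \in `[0%R, Y w[%classic)).
  have [|_] := boolP (z \in `[0%R, Y w[%classic); last by rewrite !mul0e.
  by rewrite inE/= in_itv/= => /andP[z0 _]; rewrite max_l.
by apply/idP/idP => /set_mem h; apply/mem_set; move: h; rewrite /below_graph/= in_itv.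
Qed.

Local Notation PP := [the probability _ R of P \x P].

(** The sample point z.2.1 drives the path up to time z.1, and z.2.2 drives an
    independent copy of the exponential functional started at that time. *)
Definition renewal_weight (z : R * (T * T)) : R :=
  (\1_(`[0%R, +oo[%classic : set R) z.1 * discount X e (z.1, z.2.1))%R.

Definition renewal_value (z : R * (T * T)) : R :=
  (expR (- X (Num.max z.1 0) z.2.1) * Y z.2.2)%R.

Let measurable_fst21 : measurable_fun setT (fun z : R * (T * T) => (z.1, z.2.1)).
Proof.
apply: measurable_fun_pair; first exact: measurable_fst.
exact: (measurableT_comp measurable_fst measurable_snd).
Qed.

Lemma measurable_renewal_weight : measurable_fun setT renewal_weight.
Proof.
apply: measurable_funM.
  have mD := @measurable_indic _ _ R setT _ (measurable_itv `[(0 : R)%R, +oo[).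
  exact: (measurableT_comp mD measurable_fst).
exact: (measurableT_comp (measurable_discount Xphi) measurable_fst21).
Qed.

Lemma measurable_renewal_value : measurable_fun setT renewal_value.
Proof.
have Xlevy := subordinator_levy (killed_subordinator_unkilled Xphi).
apply: measurable_funM.
  apply: measurableT_comp; first exact: measurable_expR.
  apply: measurableT_comp => //.
  have mX := measurable_right_continuous_process
    (fun t => @measurable_funPT _ _ _ _ (X t)) (levy_right_continuous Xlevy).
  exact: (measurableT_comp mX measurable_fst21).
exact: (measurableT_comp mY (measurableT_comp measurable_snd measurable_snd)).
Qed.

Lemma renewal_weight_ge0 z : (0 <= renewal_weight z)%R.
Proof. by rewrite mulr_ge0// discount_ge0. Qed.

Lemma renewal_value_ge0 z : (0 <= renewal_value z)%R.
Proof. by rewrite mulr_ge0// expR_ge0. Qed.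

Lemma integral_renewal q : (0 <= q)%R ->
  \int[mu \x PP]_z ((renewal_value z `^ q)%R%:E * (renewal_weight z)%:E) =
  ((phi (q + 1))^-1)%:E * \int[P]_w (Y w `^ q)%R%:E.
Proof.
move=> q0; have q1 : (0 < q + 1)%R by rewrite ltr_wpDl.
have mYq : measurable_fun setT (fun w => (Y w `^ q)%R%:E).
  by apply/measurable_EFinP; exact: mpow.
set K := \int[P]_w (Y w `^ q)%R%:E.
have K0 : 0 <= K by apply: integral_ge0 => w _; rewrite lee_fin powR_ge0.
rewrite fubini_tonelli1; last 2 first.
- apply: emeasurable_funM; apply/measurable_EFinP.
    by apply: mpow; exact: measurable_renewal_value.
  exact: measurable_renewal_weight.
- by move=> z; rewrite mule_ge0// lee_fin ?powR_ge0// renewal_weight_ge0.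
rewrite -(integral_expR_tail 0 (phi_gt0 q1)).
have mexp : measurable_fun (`[0%R, +oo[%classic : set R)
    (fun s : R => (expR (- phi (q + 1) * (s - 0)))%:E).
  apply/measurable_EFinP; apply: measurableT_comp; first exact: measurable_expR.
  by apply: measurable_funM => //; exact: measurable_funB.
rewrite -ge0_integralZr//.
rewrite -[RHS]integral_indicMl; apply: eq_integral => r _.
rewrite /fubini_F.
have [r0|r0] := boolP (r \in (`[0%R, +oo[%classic : set R)); last first.
  rewrite [in RHS]indicE (negbTE r0) mul0e; apply: integral0_eq => p _.
  by rewrite /renewal_weight/= indicE (negbTE r0) mul0r mule0.
have rr1 : \1_(`[0%R, +oo[%classic : set R) r = 1%R :> R by rewrite indicE r0.
have {}r0 : (0 <= r)%R by move/set_mem: r0; rewrite /= in_itv/= andbT.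
rewrite rr1 mul1e subr0.
pose a (w : T) : \bar R := (\1_(alive e r) w)%:E * (expR (- (q + 1) * X r w))%:E.
have ma : measurable_fun setT a.
  apply: emeasurable_funM; apply/measurable_EFinP.
    by apply: measurable_indic; exact: (measurable_alive Xphi).
  apply: measurableT_comp; first exact: measurable_expR.
  by apply: measurable_funM => //; exact: measurable_funPT.
have a0 w : 0 <= a w by rewrite mule_ge0// lee_fin expR_ge0.
transitivity (\int[PP]_p (a p.1 * (Y p.2 `^ q)%R%:E)).
  apply: eq_integral => -[w1 w2] _.
  rewrite /renewal_value /renewal_weight /= rr1 mul1r discountE//.
  rewrite (_ : Order.max r 0%R = r); last by rewrite max_l.
  rewrite powRM ?expR_ge0// -expRM /a -!EFinM.
  rewrite (_ : - (q + 1) * X r w1 = - X r w1 * q + - X r w1)%R; last by ring.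
  by rewrite expRD; congr EFin; ring.
have mF : measurable_fun setT (fun p : T * T => a p.1 * (Y p.2 `^ q)%R%:E).
  apply: emeasurable_funM; first exact: (measurableT_comp ma measurable_fst).
  exact: (measurableT_comp mYq measurable_snd).
have F0 p : 0 <= a p.1 * (Y p.2 `^ q)%R%:E by rewrite mule_ge0// lee_fin powR_ge0.
rewrite [LHS](@fubini_tonelli1 _ _ _ _ R P P _ mF F0).
transitivity (\int[P]_w (a w * K)).
  apply: eq_integral => w _; rewrite /fubini_F/= ge0_integralZl//.
  by move=> w' _; rewrite lee_fin powR_ge0.
rewrite ge0_integralZr//; congr (_ * _).
rewrite integral_indicMl; exact: (killed_laplace Xphi (ltW q1) r0).
Qed.

(** Both sides are the integral of z^q against measures whose integer moments
    are E[I^(n + 1)] / (n + 1) and E[I^n] / phi (n + 1).  These are equal by the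
    formula for integer moments, so that the two measures are equal. *)
Lemma power_moment_recurrence q : (0 <= q)%R ->
  \int[P]_w (Y w `^ (q + 1))%R%:E =
  ((q + 1) / phi (q + 1))%:E * \int[P]_w (Y w `^ q)%R%:E.
Proof.
move=> q0; have q1 : (0 < q + 1)%R by rewrite ltr_wpDl.
rewrite EFinM -muleA -integral_renewal//.
have phi1 : (0 < phi 1)%R by exact: phi_gt0.
have pown n : \int[P]_w (Y w `^ n%:R)%R%:E =
    (\prod_(k < n) (k.+1%:R / phi k.+1%:R))%:E.
  rewrite -real_exp_functional_moment; apply: eq_integral => w _.
  by rewrite powR_mulrn.
have eq2 n : \int[mu \x PP]_z
      ((renewal_value z ^+ n)%:E * (renewal_weight z)%:E) =
    (\prod_(k < n) (k.+1%:R / phi k.+1%:R) / phi n.+1%:R)%:E.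
  rewrite mulrC EFinM -pown -natr1 -integral_renewal//.
  by apply: eq_integral => z _; rewrite powR_mulrn// mulr_ge0 ?expR_ge0.
have eq1 n : \int[mu \x P]_z ((Num.max z.1 0 ^+ n)%:E * (\1_below_graph z)%:E) =
    (\prod_(k < n) (k.+1%:R / phi k.+1%:R) / phi n.+1%:R)%:E.
  transitivity (\int[mu \x P]_z ((Num.max z.1 0 `^ n%:R)%R%:E * (\1_below_graph z)%:E)).
    by apply: eq_integral => z _; rewrite powR_mulrn// le_max lexx orbT.
  rewrite integral_below_graph// natr1 pown -EFinM big_ord_recr/=; congr _%:E.
  by field; rewrite gt_eqF ?phi_gt0//= addrC natr1 pnatr_eq0.
rewrite -[LHS](_ : (q + 1)%:E * \int[mu \x P]_z
    ((Num.max z.1 0 `^ q)%R%:E * (\1_below_graph z)%:E) = _); last first.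
  rewrite integral_below_graph// muleA -EFinM divff ?mul1e// gt_eqF//.
congr (_ * _).
apply: (@eq_weighted_integral_of_moments R _ _ _ _ (mu \x P) (mu \x PP)
  \1_below_graph (fun z => Num.max z.1 0%R) renewal_weight renewal_value
  _ _ _ _ _ _ _ _ (phi 1)^-1 (phi 1)^-1 _ _ _ (fun x => x `^ q)%R).
- by apply: measurable_indic; exact: measurable_below_graph.
- exact: measurable_renewal_weight.
- by apply: measurable_maxr => //; exact: measurable_fst.
- exact: measurable_renewal_value.
- by [].
- exact: renewal_weight_ge0.
- by move=> z; rewrite le_max lexx orbT.
- exact: renewal_value_ge0.
- by rewrite invr_gt0.
- by move=> n; rewrite eq1 eq2.
- move=> n; rewrite eq1 lee_fin -[leRHS]mulrA [leRHS]mulrC; apply: ler_pM.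
  + by apply: prodr_ge0 => k _; rewrite divr_ge0// ltW// phi_gt0.
  + by rewrite invr_ge0 ltW// phi_gt0.
  + exact: moment_product_le.
  + rewrite lef_pV2 ?posrE ?phi_gt0//.
    by apply: (laplace_exponent_le Xphi) => //; rewrite ler1n.
- exact: measurable_powR.
- by move=> x; exact: powR_ge0.
Qed.

Let mYq q : measurable_fun setT (fun w => (Y w `^ q)%R%:E).
Proof. by apply/measurable_EFinP; exact: mpow. Qed.

Lemma size_biased_moment q n : (0 <= q)%R ->
  \int[P]_w ((Y w ^+ n)%:E * (Y w `^ q)%R%:E) =
  (\prod_(k < n) ((q + k.+1%:R) / phi (q + k.+1%:R)))%:E *
  \int[P]_w (Y w `^ q)%R%:E.
Proof.
move=> q0; transitivity (\int[P]_w (Y w `^ (q + n%:R))%R%:E).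
  apply: eq_integral => w _; rewrite -EFinM; congr EFin.
  case: n => [|n]; first by rewrite expr0 mul1r addr0.
  by rewrite powRD ?powR_mulrn// 1?mulrC// gt_eqF// ltr_wpDl.
elim: n => [|n ih]; first by rewrite big_ord0 mul1e addr0.
rewrite -natr1 addrA power_moment_recurrence ?addr_ge0// ih.
by rewrite muleA -EFinM big_ord_recr/= -natr1 addrA mulrC.
Qed.

Lemma power_moment_lty q : (0 <= q)%R -> \int[P]_w (Y w `^ q)%R%:E < +oo.
Proof.
move=> q0; pose N := Num.bound q.
have qN : (q <= N%:R)%R by rewrite ltW// archi_boundP.
apply: (@le_lt_trans _ _ (\int[P]_w (1 + (Y w ^+ N)%:E))).
  apply: ge0_le_integral => //.
  - by move=> w _; rewrite lee_fin powR_ge0.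
  - apply: emeasurable_funD => //; apply/measurable_EFinP.
    exact: measurable_funX.
  move=> w _; rewrite -EFinD lee_fin.
  have [Y1|/ltW Y1] := leP (Y w) 1%R.
    apply: (@le_trans _ _ 1%R); last by rewrite lerDl exprn_ge0.
    rewrite (_ : 1%R = (1 `^ q)%R); last by rewrite powR1.
    by rewrite ge0_ler_powR// nnegrE.
  apply: (@le_trans _ _ (Y w `^ N%:R)%R); first exact: ler_powR.
  by rewrite powR_mulrn// lerDr.
rewrite ge0_integralD//; last 2 first.
- by move=> w _; rewrite lee_fin exprn_ge0.
- by apply/measurable_EFinP; exact: measurable_funX.
rewrite real_exp_functional_moment integral_cst// mul1e.
by rewrite lte_add_pinfty ?ltry// (le_lt_trans (probability_le1 _ _)) ?ltry.
Qed.

Lemma power_moment_gt0 q : (0 <= q)%R -> 0 < \int[P]_w (Y w `^ q)%R%:E.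
Proof.
move=> q0; rewrite lt0e integral_ge0 ?andbT; last first.
  by move=> w _; rewrite lee_fin powR_ge0.
apply/eqP => B0.
have YqO : ae_eq P setT (fun w => (Y w `^ q)%R%:E) (cst 0).
  apply/ae_eq_integral_abs => //; rewrite -[RHS]B0; apply: eq_integral => w _.
  by rewrite gee0_abs// lee_fin powR_ge0.
have : \int[P]_w (Y w ^+ 1)%:E = 0.
  rewrite -(integral0 P setT); apply: ge0_ae_eq_integral => //.
  - by apply/measurable_EFinP; exact: measurable_funX.
  - by move=> w _; rewrite lee_fin exprn_ge0.
  apply: filterS YqO => w /(_ Logic.I)/= Yq0 _.
  have {}Yq0 : (Y w `^ q)%R = 0%R by exact: EFin_inj Yq0.
  by rewrite (powR_eq0_eq0 Yq0) expr1.
rewrite real_exp_functional_moment => m0.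
have /eqP : (\prod_(k < 1) (k.+1%:R / phi k.+1%:R) = 0 :> R)%R by exact: EFin_inj m0.
by rewrite big_ord1 mulf_eq0 invr_eq0 pnatr_eq0/= gt_eqF// phi_gt0.
Qed.

End power_moments.

(** * The size-biasing identity *)

Lemma T_transform_succ (R : realType) (beta : R) (phi : R -> R) n : 0 <= beta ->
  T_transform beta phi n.+1%:R =
  n.+1%:R / (beta + n.+1%:R) * phi (beta + n.+1%:R).
Proof.
move=> b0; rewrite /T_transform; case: eqP => [->|_]; last by rewrite addrC.
by rewrite add0r divff ?mul1r// pnatr_eq0.
Qed.

Theorem theorem4p1 (R : realType)
    (d : measure_display) (T : measurableType d) (P : probability T R)
    (X : R -> {RV P >-> R}) (kappa : R) (e : T -> \bar R) (phi : R -> R)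
    (d' : measure_display) (T' : measurableType d') (P' : probability T' R)
    (X' : R -> {RV P' >-> R}) (kappa' : R) (e' : T' -> \bar R) (beta : R)
    (kappa_ge0 : 0 <= kappa) (kappa'_ge0 : 0 <= kappa') (beta_ge0 : 0 <= beta)
    (Xphi : killed_subordinator X kappa e phi)
    (phi_neq0 : exists2 u, 0 <= u & phi u != 0)
    (X'phi : killed_subordinator X' kappa' e' (T_transform beta phi)) :
  let I := exp_functional (fun t => X t) e in
  let I' := exp_functional (fun t => X' t) e' in
  forall A : set (\bar R), measurable A ->
    A `<=` [set x | (0 < x < +oo)%E] ->
    (pushforward P' I' A =
     (\int[pushforward P I]_(x in A) (x `^ beta)) /
     (\int[P]_w (I w `^ beta)))%E.
Proof.
move=> I I' A mA Apos.
have phi_gt0 := laplace_exponent_gt0 Xphi phi_neq0.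
have phi'_gt0 s : 0 < s -> 0 < T_transform beta phi s.
  move=> s0; rewrite /T_transform; case: eqP => _; first exact: phi_gt0.
  have sb : 0 < s + beta by rewrite ltr_wpDr.
  by rewrite mulr_gt0 ?divr_gt0// phi_gt0.
pose Y := real_exp_functional X e; pose Y' := real_exp_functional X' e'.
have mY : measurable_fun setT Y by exact: measurable_real_exp_functional Xphi.
have mY' : measurable_fun setT Y' by exact: measurable_real_exp_functional X'phi.
have mI : measurable_fun setT I by exact: measurable_exp_functional Xphi.
have mI' : measurable_fun setT I' by exact: measurable_exp_functional X'phi.
have Y0 w : 0 <= Y w by exact: real_exp_functional_ge0.
have Y'0 w : 0 <= Y' w by exact: real_exp_functional_ge0.
have IY : (\int[P]_w (I w `^ beta) = \int[P]_w (Y w `^ beta)%:E)%E.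
  symmetry.
  apply: (integral_real_exp_functional Xphi phi_gt0 (f := fun x => x `^ beta)%E).
    exact: measurable_poweR.
  by move=> x; exact: poweR_ge0.
rewrite {}IY.
have B_gt0 := power_moment_gt0 Xphi phi_gt0 beta_ge0.
have B_lty := power_moment_lty Xphi phi_gt0 beta_ge0.
set B := (\int[P]_w (Y w `^ beta)%:E)%E in B_gt0 B_lty *.
have Bfin : B \is a fin_num by rewrite ge0_fin_numE// ltW.
pose b := fine B; have Bb : B = b%:E by rewrite fineK.
have b0 : 0 < b by rewrite -lte_fin -Bb.
pose S : set R := EFin @^-1` A.
have mS : measurable S.
  by rewrite -[S]setTI; exact: (@EFin_measurable R setT).
(* A contains neither 0 nor +oo, so that the finite part, which sends +oo to 0,
   preserves membership in A. *)
have SA x : S (fine x) <-> A x.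
  split=> [|Ax]; last first.
    rewrite /S/= fineK// fin_numElt; have /andP[x0 ->] := Apos _ Ax.
    by rewrite (lt_trans _ x0).
  case: x => [x||]//=; rewrite /S/= => /Apos/=; by rewrite ltxx.
have mom' n : (\int[P']_w ((Y' w ^+ n)%:E * (cst b w)%:E) =
    (\prod_(k < n) (k.+1%:R / T_transform beta phi k.+1%:R) * b)%:E)%E.
  rewrite EFinM -(real_exp_functional_moment X'phi phi'_gt0).
  rewrite -ge0_integralZr//.
  - by apply/measurable_EFinP; exact: measurable_funX.
  - by move=> w _; rewrite lee_fin exprn_ge0.
  - by rewrite lee_fin ltW.
(* Both sides are measures of S; their n-th moments are b times the integer
   moments for T_beta phi and the moments E[I^(beta + n)]. *)
have key : (\int[P']_w ((\1_S (Y' w))%:E * b%:E) =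
            \int[P]_w ((\1_S (Y w))%:E * (Y w `^ beta)%:E))%E.
  apply: (@eq_weighted_integral_of_moments R _ _ _ _ P' P (cst b) Y'
    (fun w => Y w `^ beta) Y _ _ _ _ _ _ _ _ b (T_transform beta phi 1)^-1
    _ _ _ \1_S) => //.
  - exact: (measurableT_comp (measurable_powR beta) mY).
  - by move=> w /=; exact: ltW.
  - by move=> w; exact: powR_ge0.
  - by rewrite invr_gt0 phi'_gt0.
  - move=> n; rewrite mom' (size_biased_moment Xphi phi_gt0)// -/B Bb -EFinM.
    congr (_ * _)%:E; apply: eq_bigr => k _; rewrite T_transform_succ//.
    have bk : 0 < beta + k.+1%:R by rewrite ltr_wpDl.
    by field; rewrite (addrC 1) natr1 pnatr_eq0 (gt_eqF bk) gt_eqF ?phi_gt0.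
  - move=> n; rewrite mom' lee_fin [leLHS]mulrC -[leRHS]mulrA ler_wpM2l ?(ltW b0)//.
    exact: (moment_product_le X'phi phi'_gt0).
have -> : pushforward P' I' A = (\int[P']_w (\1_S (Y' w))%:E)%E.
  rewrite (_ : (fun w => (\1_S (Y' w))%:E) = (fun w => (\1_(I' @^-1` A) w)%:E)).
    rewrite integral_indic ?setIT// -[X in measurable X]setTI; exact: mI'.
  apply/funext => w; rewrite !indicE; congr (nat_of_bool _)%:R%:E.
  by apply/idP/idP => /set_mem h; apply/mem_set; apply/SA.
have -> : (\int[pushforward P I]_(x in A) (x `^ beta) =
    \int[P]_w ((\1_S (Y w))%:E * (Y w `^ beta)%:E))%E.
  rewrite ge0_integral_pushforward//; last 2 first.
  - by apply: measurable_funTS; exact: measurable_poweR.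
  - by move=> x _; exact: poweR_ge0.
  rewrite -[LHS]integral_indicMl; apply: eq_integral => w _.
  rewrite !indicE (_ : (w \in I @^-1` A) = (Y w \in S)); last first.
    by apply/idP/idP => /set_mem h; apply/mem_set; apply/SA.
  have [/set_mem/SA/Apos/andP[I0 Ioo]|_] := boolP (Y w \in S); last by rewrite !mul0e.
  rewrite !mul1e /= -[I w]fineK// fin_numElt Ioo andbT.
  exact: lt_trans I0.
have mSY : measurable_fun setT (fun w => (\1_S (Y' w) : R)%:E).
  apply/measurable_EFinP.
  exact: (measurableT_comp (@measurable_indic _ _ R setT _ mS) mY').
rewrite -{}key ge0_integralZr ?lee_fin ?(ltW b0)//.
by rewrite Bb -muleA divee ?mule1// gt_eqF// lte_fin.
Qed.
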